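(* Let $Q\subset\mathbb{R}$ be an interval, $p_1\in[1,2]$ and $p_2\in[2,\infty)$. Then for every $\varphi\in\mathrm{BMO}(Q)$, $$\langle|\varphi-\langle\varphi\rangle_Q|^{p_1}\rangle_Q^{p_2/p_1}\le\langle|\varphi-\langle\varphi\rangle_Q|^{p_2}\rangle_Q\le\frac{p_2\Gamma(p_2)}{p_1\Gamma(p_1)}\,\|\varphi\|_{\mathrm{BMO}(Q)}^{p_2-p_1}\,\langle|\varphi-\langle\varphi\rangle_Q|^{p_1}\rangle_Q .$$ Moreover, these inequalities are sharp and attainable: for each of the two inequalities there is $\varphi\in\mathrm{BMO}(Q)$ with $\|\varphi\|_{\mathrm{BMO}(Q)}\ne0$ for which it is an equality.
   Context: ''Interval'' means a bounded interval of positive length in $\mathbb{R}$; functions are real-valued. For an interval $J$, $\langle\varphi\rangle_J=\frac1{|J|}\int_J\varphi$. For an interval $Q$, $\mathrm{BMO}(Q)$ is the set of $\varphi\in L^1(Q)$ such that $\|\varphi\|_{\mathrm{BMO}(Q)}=\sup_{J\subset Q}\big(\langle\varphi^2\rangle_J-\langle\varphi\rangle_J^2\big)^{1/2}<\infty$, the supremum being over all subintervals $J$ of $Q$. $\Gamma$ is the Euler Gamma function. *)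

(* Defs.v *)
From HB Require Import structures.
From mathcomp Require Import all_boot all_order all_algebra.
From mathcomp Require Import all_classical all_reals all_analysis.
Set Implicit Arguments.
Unset Strict Implicit.
Unset Printing Implicit Defensive.
Import Order.TTheory GRing.Theory Num.Theory.
Import numFieldNormedType.Exports.
Local Open Scope classical_set_scope.
Local Open Scope ring_scope.

(* A function on an interval Q is represented by a total
   function R -> R whose values outside Q never matter. *)

(* The endpoints may or may not belong to the interval. *)
Definition bounded_interval (R : realType) (J : set R) : Prop :=
  [/\ is_interval J, bounded_set J & (0 < lebesgue_measure J)%E].

(* The average is extended-real-valued, so that the average of a nonnegative
   non-integrable function is +oo and not a junk real value. *)
Definition avg (R : realType) (J : set R) (f : R -> R) : \bar R :=
  ((lebesgue_measure J)^-1 * \int[lebesgue_measure]_(x in J) (f x)%:E)%E.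

Definition bmo_norm (R : realType) (Q : set R) (phi : R -> R) : \bar R :=
  ereal_sup [set ((avg J (fun x => phi x ^+ 2)%R - avg J phi ^+ 2) `^ 2^-1)%E
            | J in [set J | bounded_interval J /\ J `<=` Q]].

Definition in_BMO (R : realType) (Q : set R) (phi : R -> R) : Prop :=
  lebesgue_measure.-integrable Q (EFin \o phi) /\ (bmo_norm Q phi < +oo)%E.

(* <|phi - <phi>_Q|^p>_Q.  For phi in L^1(Q) the average of phi is finite, so
   fine loses nothing. *)
Definition central_moment (R : realType) (Q : set R) (phi : R -> R) (p : R)
    : \bar R :=
  avg Q (fun x => `|phi x - fine (avg Q phi)| `^ p).

(* Euler's integral, which converges exactly for s > 0; otherwise the value is
   the default 0 of the real-valued integral. *)
Definition Gamma (R : realType) (s : R) : R :=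
  \int[lebesgue_measure]_(x in `]0, +oo[) (x `^ (s - 1) * expR (- x)).

(* Main.v *)
Require Import Defs.
From HB Require Import structures.
From mathcomp Require Import all_boot all_order all_algebra.
From mathcomp Require Import all_classical all_reals all_analysis.
From mathcomp Require Import ring lra measurable_realfun.
Import Order.TTheory GRing.Theory Num.Theory.
Import numFieldNormedType.Exports.
Local Open Scope classical_set_scope.
Local Open Scope ring_scope.
Set Implicit Arguments.
Unset Strict Implicit.
Unset Printing Implicit Defensive.

(** Write X for the distance of phi to its mean.  The left inequality is the
    convexity of a power (power_mean).

    For the right inequality, scale phi so that its norm is 1, and compare X
    with an exponential variable.  The heart is a statement about a function
    psi >= 0 whose oscillation is at most 1 on every subinterval and whose
    mean over the interval is at most 1: then the mean of psi^2 is at most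
    twice the mean of psi (sqr_le_of_mean_le1).  The rising sun lemma cuts the
    interval, up to a null set, into intervals over which the mean of psi is
    exactly 1, so that the mean of psi^2 there is at most 1 + 1, and a set on
    which psi <= 1, so that psi^2 <= psi (sunrise_square).

    This applies to psi = (X - t)_+, because a 1-Lipschitz function of phi
    oscillates no more than phi.  Since the integral G(t) of (X - t)_+^2 has
    derivative minus twice the integral of (X - t)_+, it says that G' <= - G,
    hence G(t) <= e^-t G(0) (excess_sqr_decay), with equality for exponential
    variables.  Now u^p is, up to a positive factor, the integral over t > 0,
    with weight t^(p-3), of (u - t)_+^2 if p > 2, and of u^2 - (u - t)_+^2 if
    1 < p < 2.  Integrating the bound on G against this weight compares the
    p-th moment of X with its second moment, from above if p >= 2
    (moment_le_sqr) and from below if p <= 2 (sqr_le_moment).  The factor is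
    never needed: the same computation with equality for the exponential
    variable - ln x on ]0, 1[, whose p-th moment is p Gamma(p), eliminates it.
    Chaining the comparison for p2 with the one for p1 gives the theorem
    (central_moment_upper).

    Both inequalities are attained: the left one by a function equal to 1 on
    one half of the interval and to -1 on the other, since X is constant; the
    right one by a function that vanishes in the middle and behaves as an
    exponential variable and its opposite near the two ends (two_sided_log).
    Its norm is at most 1 by direct estimates, and the right inequality itself
    forbids a smaller norm. *)

(** * The rising sun lemma *)

Lemma continuous_lt_near (R : realType) (F : R -> R) (y v : R) :
  {for y, continuous F} -> F y < v ->
  exists2 e : R, 0 < e & forall z, `|y - z| < e -> F z < v.
Proof.
move=> cF Fyv.
have : \forall z \near y, F z < v by exact: (@cvgr_lt _ _ _ _ F (F y) cF).
by move=> /nbhs_ballP[e /= e0 H]; exists e => // z; exact: H.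
Qed.

(** Take the infimum of the points of [c, d] where F <= v: F is at most v there
    by continuity, and at least v because F > v just before it, or F c >= v. *)
Lemma first_hit (R : realType) (F : R -> R) (c d v : R) : c <= d ->
  (forall x, c <= x <= d -> {for x, continuous F}) -> F d <= v <= F c ->
  exists y, [/\ c <= y <= d, F y = v & forall z, c <= z -> z < y -> v < F z].
Proof.
move=> cd cF /andP[Fdv vFc].
pose S : set R := [set x | c <= x <= d /\ F x <= v].
have Sd : S d by split => //; rewrite cd lexx.
have infS : has_inf S by split; [exists d | exists c => x [/andP[]]].
have cy : c <= inf S by apply: lb_le_inf; [exists d | move=> x [/andP[]]].
have yd : inf S <= d by apply: ge_inf => //; case: infS.
have gtv z : c <= z -> z < inf S -> v < F z.
  move=> cz zy; rewrite ltNge; apply/negP => Fzv.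
  suff : inf S <= z by rewrite leNgt zy.
  apply: ge_inf; first by case: infS.
  by split => //; rewrite cz (le_trans (ltW zy)).
have cFy : {for inf S, continuous F} by apply: cF; rewrite cy.
exists (inf S); split => //; first by rewrite cy.
apply/eqP; rewrite eq_le; apply/andP; split; rewrite leNgt; apply/negP => lt.
- have [||e e0 H] := @continuous_lt_near R (\- F) (inf S) (- v).
  + exact: continuousN.
  + by rewrite ltrN2.
  have [s [/andP[cs sd] Fsv] sy] := inf_adherent e0 infS.
  have ys : inf S <= s.
    by apply: ge_inf; [case: infS | split => //; rewrite cs].
  have /H : `|inf S - s| < e by rewrite ltr_norml; apply/andP; split; lra.
  by rewrite ltrN2 ltNge Fsv.
- have [cy'|cy'] := eqVneq c (inf S).
    by move: lt; rewrite -cy' ltNge vFc.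
  have {}cy' : c < inf S by rewrite lt_neqAle cy' cy.
  have [e e0 H] := continuous_lt_near cFy lt.
  pose z := Num.max c (inf S - e / 2).
  have zy : z < inf S by rewrite /z gt_max cy'/=; lra.
  have cz : c <= z by rewrite /z le_max lexx.
  have := gtv z cz zy; rewrite ltNge (ltW (H z _))//.
  have : inf S - e / 2 <= z by rewrite /z le_max lexx orbT.
  by rewrite ltr_norml => ?; apply/andP; split; lra.
Qed.

Lemma open_itv_oo (R : realType) (I : set R) (a b : R) : open I -> is_interval I ->
  I !=set0 -> I `<=` `]a, b[ ->
  exists c d, [/\ a <= c, c < d, d <= b & I = `]c, d[%classic].
Proof.
move=> oI iI [x0 Ix0] Iab.
have hl : has_lbound I by exists a => x /Iab/=; rewrite in_itv/= => /andP[/ltW].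
have hu : has_ubound I by exists b => x /Iab/=; rewrite in_itv/= => /andP[_ /ltW].
have II : I = `]inf I, sup I[%classic.
  have := interval_bounded_interior iI hl hu.
  have -> : I^° = I by apply/seteqP; split;
    [exact: interior_subset|rewrite -open_subsetE].
  by move=> {1}->; apply/seteqP; split => x /=; rewrite in_itv.
exists (inf I), (sup I); split => //.
- by apply: lb_le_inf; [exists x0|move=> x /Iab/=; rewrite in_itv/= => /andP[/ltW]].
- by move: Ix0; rewrite {1}II/= in_itv/= => /andP[]; exact: lt_trans.
- by apply: ge_sup; [exists x0|move=> x /Iab/=; rewrite in_itv/= => /andP[_ /ltW]].
Qed.

(** The points that a sun rising on the left leaves in the shadow when the
    graph of F is seen upside down.  On the complement F is equal to its
    running minimum. *)
Definition sun_shadow (R : realType) (F : R -> R) (a b : R) : set R :=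
  [set x | a < x < b /\ exists2 z, a <= z < x & F z < F x].

Lemma open_sun_shadow (R : realType) (F : R -> R) (a b : R) :
  (forall x, a <= x <= b -> {for x, continuous F}) ->
  open (sun_shadow F a b).
Proof.
move=> cF; rewrite openE => x [/andP[ax xb] [z /andP[az zx] Fzx]].
rewrite /interior; apply/nbhs_ballP.
have cFx : {for x, continuous F} by apply: cF; rewrite !ltW.
have [||e e0 H] := @continuous_lt_near R (\- F) x (- F z).
- exact: continuousN.
- by rewrite ltrN2.
exists (Num.min e (Num.min (x - z) (b - x))) => /=.
  by rewrite !lt_min e0 !subr_gt0 zx.
move=> y; rewrite /ball/= !lt_min => /and3P[ye].
rewrite !ltr_norml => /andP[? ?] /andP[? ?]; split.
  by apply/andP; split; lra.
exists z; first by rewrite az/=; lra.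
by have := H y ye; rewrite ltrN2.
Qed.

(** F d <= F c because d is lit, or because of the hypothesis on F b if the
    component ends there.  If F d < F c, then F takes a value strictly between
    the two for the first time at a point of ]c, d[, and this point is lit
    because F >= F c to the left of c. *)
Lemma sun_shadow_component (R : realType) (F : R -> R) (a b c d : R) :
  (forall x, a <= x <= b -> {for x, continuous F}) ->
  (forall x, a <= x < b -> F b < F x) ->
  a <= c -> c < d -> d <= b ->
  `]c, d[ `<=` sun_shadow F a b ->
  ~ sun_shadow F a b c -> ~ sun_shadow F a b d -> F c = F d.
Proof.
move=> cF Fb ac cd db sub nc nd.
have cb : c < b := lt_le_trans cd db.
have ad : a < d := le_lt_trans ac cd.
have minc z : a <= z <= c -> F c <= F z.
  move=> /andP[az]; rewrite le_eqVlt => /predU1P[->//|zc].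
  rewrite leNgt; apply/negP => Fzc; apply: nc; split.
    by rewrite (le_lt_trans az zc).
  by exists z => //; rewrite az.
have Fdc : F d <= F c.
  rewrite leNgt; apply/negP => Fcd.
  move: db; rewrite le_eqVlt => /predU1P[db|db].
    by have := Fb c; rewrite ac cb -db => /(_ isT); rewrite ltNge (ltW Fcd).
  by apply: nd; split; [rewrite ad|exists c => //; rewrite ac].
apply/eqP; rewrite eq_le Fdc andbT leNgt; apply/negP => lt.
pose v := (F c + F d) / 2.
have [vc dv] : v < F c /\ F d < v by rewrite /v; split; lra.
have [||y [/andP[cy yd] Fy ymin]] := @first_hit R F c d v (ltW cd).
- by move=> x /andP[cx xd]; apply: cF; rewrite (le_trans ac cx) (le_trans xd db).
- by rewrite !ltW.
have {}cy : c < y.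
  by rewrite lt_neqAle cy andbT; apply/eqP => E; move: vc; rewrite E Fy ltxx.
have {}yd : y < d.
  by rewrite lt_neqAle yd andbT; apply/eqP => E; move: dv; rewrite -E Fy ltxx.
have [|_ [z /andP[az zy] Fzy]] := sub y; first by rewrite /= in_itv/= cy.
move: Fzy; rewrite Fy; apply/negP; rewrite -leNgt.
have [zc|cz] := leP z c; last exact/ltW/ymin/zy/ltW.
by rewrite (le_trans (ltW vc))// minc// az.
Qed.

(** * Quadratic means by the rising sun lemma *)

(** A difference quotient taken from the left of a left minimum is
    nonpositive. *)
Lemma derive1_le0_left (R : realType) (F : R -> R) (a x : R) : a < x ->
  derivable F x 1 -> (forall z, a <= z < x -> F x <= F z) -> F^`()%classic x <= 0.
Proof.
move=> ax dF Fx; rewrite leNgt; apply/negP => lt.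
have /(@cvgr_gt _ _ _ _ _ _) : (fun h : R => h^-1 *: (F (h + x) - F x))
  @ 0^' --> F^`()%classic x.
  have -> : (fun h : R => h^-1 *: (F (h + x) - F x)) =
      (fun h : R => h^-1 *: ((F \o shift x) (h *: (1 : R)) - F x)).
    by apply/funext => h /=; rewrite [X in _ = _ *: (F (X + _) - _)]mulr1.
  rewrite derive1E; exact: dF.
move=> /(_ _ lt)/nbhs_ballP[e /= e0 H].
pose h : R := Num.min (e / 2) (x - a).
have h0 : 0 < h by rewrite lt_min subr_gt0 ax andbT divr_gt0.
have := H (- h); rewrite /ball/= sub0r opprK gtr0_norm//.
have he : h < e by rewrite gt_min; apply/orP; left; lra.
have hx : h <= x - a by rewrite ge_min lexx orbT.
move=> /(_ he); rewrite oppr_eq0 gt_eqF// => /(_ isT).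
rewrite -[_ *: _]/(_ * _) invrN mulNr -mulrN pmulr_rgt0 ?invr_gt0//.
rewrite oppr_gt0 subr_lt0 ltNge Fx//; apply/andP; split; lra.
Qed.

(** Stated by comparing two integrals, so that it passes to disjoint unions
  without dividing by the
    measure of S. *)
Definition rms_le (R : realType) (f : R -> R) (eps : R) (S : set R) : Prop :=
  (\int[lebesgue_measure]_(x in S) ((f x)^+2)%:E <=
   \int[lebesgue_measure]_(x in S) (eps^+2)%:E)%E.

Section sunrise.
Context {R : realType}.
Notation mu := (@lebesgue_measure R).
Variables (f : R -> R) (a b eps : R).
Hypothesis ab : a <= b.
Hypothesis intf : mu.-integrable setT (EFin \o f).

Let F x := parameterized_integral mu (a - 1) x f.

Let mf : measurable_fun setT f.
Proof. by apply/measurable_EFinP; case/integrableP: intf. Qed.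

Let mf2 (S : set R) : measurable_fun S (fun x => ((f x)^+2)%:E).
Proof.
apply/measurable_EFinP; apply: (@measurable_funS _ _ _ _ setT) => //.
exact: measurable_funX.
Qed.

Let cF x : a <= x <= b -> {for x, continuous F}.
Proof.
move=> /andP[ax xb].
have ab1 : a - 1 < b + 1 by lra.
have := @parameterized_integral_continuous R (a - 1) (b + 1) f (ltW ab1) _.
move=> /(_ _)/(continuous_within_itvP _ ab1)[|+ _ _]; first exact: integrableS intf.
apply; rewrite in_itv/=; apply/andP; split; lra.
Qed.

Let incF c d : a <= c -> c < d -> \int[mu]_(x in `]c, d[) f x = F d - F c.
Proof.
move=> ac cd; rewrite Rintegral_itv_bndo_bndc; last exact: integrableS intf.
rewrite /F /parameterized_integral Rintegral_itvB//.
- exact: integrableS intf.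
- by rewrite bnd_simp; lra.
- by rewrite bnd_simp ltW.
Qed.

Local Notation P := (rms_le f eps).

Let f2ge0 x : (0 <= ((f x)^+2)%:E)%E. Proof. by rewrite lee_fin sqr_ge0. Qed.
Let e2ge0 : (0 <= (eps^+2)%:E)%E. Proof. by rewrite lee_fin sqr_ge0. Qed.

Let PU (A B : set R) : measurable A -> measurable B -> [disjoint A & B] ->
  P A -> P B -> P (A `|` B).
Proof.
move=> mA mB AB PA PB; rewrite /rms_le ge0_integral_setU//; last exact: mf2.
rewrite [leRHS]ge0_integral_setU//; exact: leeD.
Qed.

Let Pbigcup (I : nat -> set R) : (forall i, measurable (I i)) -> trivIset setT I ->
  (forall i, P (I i)) -> P (\bigcup_i I i).
Proof.
move=> mI tI PI; rewrite /rms_le ge0_integral_bigcup//; last exact: mf2.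
rewrite [leRHS]ge0_integral_bigcup//.
apply: lee_nneseries => [i _ _|i _]; [exact: integral_ge0|exact: PI].
Qed.

Hypothesis fge : forall x, a <= x <= b -> - eps <= f x.
Hypothesis mean0 : forall c d, a <= c -> c < d -> d <= b ->
  \int[mu]_(x in `]c, d[) f x = 0 -> P `]c, d[.

Let Pshadow e : a < e -> e <= b -> (forall x, a <= x < e -> F e < F x) ->
  P (sun_shadow F a e).
Proof.
move=> ae eb Fe.
have oE : open (sun_shadow F a e).
  apply: open_sun_shadow => x /andP[ax xe]; apply: cF.
  by rewrite ax (le_trans xe).
rewrite (open_disjoint_itv_bigcup oE); apply: Pbigcup.
- by move=> i; apply: open_measurable; exact: open_disjoint_itv_open.
- exact: open_disjoint_itv_trivIset.
move=> i; set I := open_disjoint_itv oE i.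
have [->|/set0P I0] := eqVneq I set0; first by rewrite /rms_le !integral_set0.
have sI : I `<=` sun_shadow F a e.
  by rewrite (open_disjoint_itv_bigcup oE); exact: bigcup_sup.
have [||//|x /sI[xe _]|c [d [ac cd de IE]]] := @open_itv_oo R I a e.
- exact: open_disjoint_itv_open.
- exact: open_disjoint_itv_is_interval.
- by rewrite /= in_itv.
(* an endpoint lying in the shadow would belong to a component meeting I,
   hence to I itself *)
have nin x : x \in `[c, d] -> ~ I x -> ~ sun_shadow F a e x.
  move=> xcd nIx; rewrite (open_disjoint_itv_bigcup oE) => -[j _].
  set J := open_disjoint_itv oE j => Jx.
  have ij : J `&` I !=set0.
    have [eps1 /= eps10 H] := open_subball (@open_disjoint_itv_open R _ oE j) Jx.
    have [y By Iy] : exists2 y, ball x (eps1 / 2) y & I y.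
      rewrite IE; move: xcd; rewrite in_itv/= => /andP[cx].
      rewrite le_eqVlt => /predU1P[xd|xd].
        have [? ?] : Num.max (x - eps1 / 4) ((c + d) / 2) < x /\
            x - eps1 / 4 <= Num.max (x - eps1 / 4) ((c + d) / 2).
          by rewrite gt_max le_max lexx; split => //; apply/andP; split; lra.
        have ? : (c + d) / 2 <= Num.max (x - eps1 / 4) ((c + d) / 2).
          by rewrite le_max lexx orbT.
        exists (Num.max (x - eps1 / 4) ((c + d) / 2)).
          by rewrite /ball/= ltr_norml; apply/andP; split; lra.
        by rewrite /= in_itv/=; apply/andP; split; lra.
      have [? ?] : x < Num.min (x + eps1 / 4) ((x + d) / 2) /\
          Num.min (x + eps1 / 4) ((x + d) / 2) <= x + eps1 / 4.
        by rewrite lt_min ge_min lexx; split => //; apply/andP; split; lra.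
      have ? : Num.min (x + eps1 / 4) ((x + d) / 2) <= (x + d) / 2.
        by rewrite ge_min lexx orbT.
      exists (Num.min (x + eps1 / 4) ((x + d) / 2)).
        by rewrite /ball/= ltr_norml; apply/andP; split; lra.
      by rewrite /= in_itv/=; apply/andP; split; lra.
    exists y; split => //; apply: (H (eps1 / 2)) => //; last by lra.
    by rewrite /ball/= sub0r normrN gtr0_norm; lra.
  have := @open_disjoint_itv_trivIset R _ oE j i Logic.I Logic.I ij.
  by move=> ji; apply: nIx; rewrite /I -ji.
rewrite IE; apply: mean0 => //; first exact: le_trans eb.
rewrite incF// (@sun_shadow_component _ F a e c d) ?subrr//.
- by move=> x /andP[ax xe]; apply: cF; rewrite ax (le_trans xe).
- by rewrite -IE.
- apply: nin; first by rewrite in_itv/= lexx ltW.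
  by rewrite IE/= in_itv/= ltxx.
- apply: nin; first by rewrite in_itv/= lexx ltW.
  by rewrite IE/= in_itv/= ltxx andbF.
Qed.

Let Pcomplement e : a < e -> e <= b ->
  P (`]a, e[ `\` sun_shadow F a e).
Proof.
move=> ae eb.
have mE : measurable (sun_shadow F a e).
  apply: open_measurable; apply: open_sun_shadow => x /andP[ax xe]; apply: cF.
  by rewrite ax (le_trans xe).
have mD : measurable (`]a, e[ `\` sun_shadow F a e) by exact: measurableD.
apply: ae_ge0_le_integral => //; first exact: mf2.
have locf : locally_integrable [set: R] f.
  by apply: open_integrable_locally => //; exact: openT.
apply: filterS (lebesgue_differentiation locf);
  first exact: (ae_filter_ringOfSetsType mu).
move=> x Lx [/=]; rewrite in_itv/= => /andP[ax xe] nE.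
have [|||dF F'] := @FTC1_lebesgue_pt R f (BLeft (a - 1)) x (x + 1) _ _ _ Lx.
- by rewrite ltrDl.
- exact: integrableS intf.
- by rewrite /= lte_fin; lra.
have fx : f x <= 0.
  rewrite -F'; apply: (derive1_le0_left ax dF) => z /andP[az zx].
  rewrite leNgt; apply/negP => Fzx; apply: nE; split; first by rewrite ax.
  by exists z => //; rewrite az.
have := @fge x; rewrite (ltW ax) (le_trans (ltW xe) eb) => /(_ isT) ?.
by rewrite lee_fin -(@sqrrN _ (f x)) ler_sqr ?nnegrE; lra.
Qed.

(** With F the primitive of f, the last value F b <= F a is first taken at a
    point e.  The mean of f vanishes over ]e, b[ and over every component of
    the shadow of F in ]a, e[; outside the shadow F is a running minimum, so
    that - eps <= f = F' <= 0 at almost every point.  On each of these pieces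
    the root mean square is at most eps. *)
Lemma sunrise_square : \int[mu]_(x in `]a, b[) f x <= 0 -> P `]a, b[.
Proof.
move=> I0.
move: ab; rewrite le_eqVlt => /predU1P[->|ab'].
  by rewrite set_itvoo0 /P !integral_set0.
have Fba : F b <= F a by rewrite -subr_le0 -incF.
have [||e [/andP[ae eb] Fe eF]] := @first_hit R F a b (F b) ab.
- exact: cF.
- by rewrite lexx.
(* cutting at e leaves no exceptional component at the right end *)
have Peb : P `]e, b[.
  move: eb; rewrite le_eqVlt => /predU1P[->|eb].
    by rewrite set_itvoo0 /P !integral_set0.
  by apply: mean0 => //; rewrite incF// Fe subrr.
have [Eae|nae] := eqVneq a e; first by rewrite Eae.
have {nae}ae' : a < e by rewrite lt_neqAle nae ae.

have Pae : P `]a, e[.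
  have sE : sun_shadow F a e `<=` `]a, e[ by move=> x [].
  rewrite -(setDUK sE); apply: PU.
  - apply: open_measurable; apply: open_sun_shadow => x /andP[ax xe]; apply: cF.
    by rewrite ax (le_trans xe).
  - apply: measurableD => //.
    apply: open_measurable; apply: open_sun_shadow => x /andP[ax xe]; apply: cF.
    by rewrite ax (le_trans xe).
  - by apply/disj_setPS => x [? []].
  - by apply: Pshadow => // x /andP[ax xe]; rewrite Fe; exact: eF.
  - exact: Pcomplement.
rewrite (@itv_bndbnd_setU _ _ _ (BLeft e)) ?bnd_simp//.
apply: PU => //.
- by apply/disj_setPS => x []/=; rewrite !in_itv/=; lra.
- by rewrite /rms_le -!integral_itv_obnd_cbnd//; exact: mf2.
Qed.
End sunrise.

(** * Functions with small mean and bounded oscillation *)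

Section nonneg_integrals.
Context {R : realType}.
Notation mu := (@lebesgue_measure R).
Implicit Types (f g : R -> R) (S : set R).

Lemma nnint_ge0 f S : (forall x, 0 <= f x) ->
  (0 <= \int[mu]_(x in S) (f x)%:E)%E.
Proof. by move=> f0; apply: integral_ge0 => x _; rewrite lee_fin. Qed.

Lemma le_nnint f g S : measurable S -> measurable_fun setT f ->
  measurable_fun setT g -> (forall x, S x -> 0 <= f x <= g x) ->
  (\int[mu]_(x in S) (f x)%:E <= \int[mu]_(x in S) (g x)%:E)%E.
Proof.
move=> mS mf mg fg; apply: ge0_le_integral => //.
- by move=> x /fg/andP[f0 _]; rewrite lee_fin.
- by apply/measurable_EFinP; exact: measurable_funTS.
- by apply/measurable_EFinP; exact: measurable_funTS.
- by move=> x /fg/andP[_]; rewrite lee_fin.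
Qed.

Lemma nnintD f g S : measurable S -> measurable_fun setT f ->
  measurable_fun setT g -> (forall x, S x -> 0 <= f x) -> (forall x, S x ->
    0 <= g x) ->
  (\int[mu]_(x in S) (f x + g x)%:E =
   \int[mu]_(x in S) (f x)%:E + \int[mu]_(x in S) (g x)%:E)%E.
Proof.
move=> mS mf mg f0 g0; under eq_integral do rewrite EFinD.
rewrite ge0_integralD//.
- by apply/measurable_EFinP; exact: measurable_funTS.
- by apply/measurable_EFinP; exact: measurable_funTS.
Qed.

Lemma nnintZ f S (k : R) : measurable S -> measurable_fun setT f ->
  (forall x, S x -> 0 <= f x) -> 0 <= k ->
  (\int[mu]_(x in S) (k * f x)%:E = k%:E * \int[mu]_(x in S) (f x)%:E)%E.
Proof.
move=> mS mf f0 k0; under eq_integral do rewrite EFinM.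
rewrite ge0_integralZl_EFin//.
by apply/measurable_EFinP; exact: measurable_funTS.
Qed.

Lemma nnint_cst_oo (k c d : R) : c <= d ->
  (\int[mu]_(x in `]c, d[) k%:E = (k * (d - c))%:E)%E.
Proof.
move=> cd; rewrite integral_cst//= lebesgue_measure_itv/= lte_fin.
move: cd; rewrite le_eqVlt => /predU1P[->|cd]; last by rewrite cd -EFinB -EFinM.
by rewrite ltxx subrr mulr0 mule0.
Qed.

(** Integrate (psi - k)^2 + 2 k psi = psi^2 + k^2: as every term is nonnegative,
    this holds without integrability, infinite values included. *)
Lemma nnint_sqr_shift (psi : R -> R) (k c d : R) : c <= d ->
  measurable_fun setT psi -> (forall x, 0 <= psi x) -> 0 <= k ->
  (\int[mu]_(x in `]c, d[) ((psi x - k)^+2)%:E +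
     (2 * k)%:E * \int[mu]_(x in `]c, d[) (psi x)%:E =
   \int[mu]_(x in `]c, d[) ((psi x)^+2)%:E + (k^+2 * (d - c))%:E)%E.
Proof.
move=> cd mpsi psi0 k0.
have mk : measurable_fun setT (fun x => (psi x - k)^+2).
  by apply: measurable_funX; exact: measurable_funB.
have mp2 : measurable_fun setT (fun x => (psi x)^+2) by exact: measurable_funX.
have mkp : measurable_fun setT (fun x => 2 * k * psi x) by exact: measurable_funM.
have k2 : 0 <= 2 * k by rewrite mulr_ge0.
rewrite -nnintZ// -nnint_cst_oo//.
rewrite -nnintD//; [|by move=> x _; rewrite sqr_ge0|by move=> x _;
  rewrite mulr_ge0].
rewrite -nnintD//; [|by move=> x _; rewrite sqr_ge0|by move=> x _; rewrite sqr_ge0].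
by apply: eq_integral => x _; congr (_%:E); ring.
Qed.

End nonneg_integrals.

Section small_mean.
Context {R : realType}.
Notation mu := (@lebesgue_measure R).
Variables (psi : R -> R) (a b : R).
Hypotheses (ab : a < b) (mpsi : measurable_fun setT psi) (psi0 : forall x, 0 <=
  psi x).

(** Apply the rising sun argument to f = psi - 1 >= -1.  Over an interval where
    f has mean 0, the mean of f^2 is the least mean of (psi - k)^2 over all k,
    hence at most 1.  The conclusion on f^2 is the expanded form of the one on
    psi. *)
Lemma sqr_le_of_mean_le1 :
  (forall c d, a <= c -> c < d -> d <= b -> exists2 k : R, 0 <= k &
     (\int[mu]_(x in `]c, d[) ((psi x - k)^+2)%:E <= (d - c)%:E)%E) ->
  (\int[mu]_(x in `]a, b[) (psi x)%:E <= (b - a)%:E)%E ->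
  (\int[mu]_(x in `]a, b[) ((psi x)^+2)%:E <=
   2%:E * \int[mu]_(x in `]a, b[) (psi x)%:E)%E.
Proof.
move=> osc mean1.
pose f : R -> R := (psi \- cst 1) \_ `]a, b[%classic.
have ipsi : mu.-integrable `]a, b[ (EFin \o psi).
  apply/integrableP; split; first by apply/measurable_EFinP;
    exact: measurable_funTS.
  under eq_integral do rewrite /= ger0_norm//.
  by apply: le_lt_trans mean1 _; exact: ltry.
have i1 : mu.-integrable `]a, b[ (EFin \o (cst 1 : R -> R)).
  apply: measurable_bounded_integrable => //=.
  - by rewrite lebesgue_measure_itv/= lte_fin ab -EFinB ltry.
  - exact: bounded_cst.
have fE c d : a <= c -> d <= b -> {in `]c, d[%classic, f =1 (fun x => psi x - 1)}.
  move=> ac db x; rewrite inE/= in_itv/= => /andP[cx xd];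
    rewrite /f patchE mem_set//=.
  by rewrite in_itv/= (le_lt_trans ac cx) (lt_le_trans xd db).
have fsq c d : a <= c -> d <= b ->
    (\int[mu]_(x in `]c, d[) ((f x)^+2)%:E = \int[mu]_(x in `]c, d[)
      ((psi x - 1)^+2)%:E)%E.
  by move=> ac db; apply: eq_integral => x xcd; rewrite (fE c d).
have fsum c d : a <= c -> c < d -> d <= b ->
    \int[mu]_(x in `]c, d[) f x = fine (\int[mu]_(x in `]c, d[) (psi x)%:E) -
      (d - c).
  move=> ac cd db; rewrite (eq_Rintegral mu (g := fun x => psi x - 1));
    last exact: fE.
  have sub : `]c, d[ `<=` `]a, b[ by apply: subset_itvW.
  rewrite RintegralB//; [|exact: integrableS ipsi|exact: integrableS i1].
  rewrite Rintegral_cst// mul1r /= lebesgue_measure_itv/= lte_fin cd.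
  by [].
have psifin c d : a <= c -> c < d -> d <= b ->
    (\int[mu]_(x in `]c, d[) (psi x)%:E)%E \is a fin_num.
  move=> ac cd db; apply: integrable_fin_num => //; apply: integrableS ipsi => //.
  exact: subset_itvW.
have : rms_le f 1 `]a, b[.
  apply: (sunrise_square (ltW ab)).
  - rewrite /f -restrict_EFin; apply: (integrable_mkcond _ _).1 => //.
    by apply: eq_integrable (integrableB _ ipsi i1) => // x _; rewrite /= EFinB.
  - move=> x _; rewrite /f patchE; case: ifPn => _; last by rewrite lerN10.
    by rewrite /= lerBrDr addrC subrr.
  - move=> c d ac cd db; rewrite fsum// => /eqP; rewrite subr_eq0 => /eqP E.
    have {}E : (\int[mu]_(x in `]c, d[) (psi x)%:E = (d - c)%:E)%E.
      by rewrite -E fineK// psifin.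
    rewrite /rms_le fsq// expr1n nnint_cst_oo ?(ltW cd)// mul1r.
    have [k k0 Hk] := osc _ _ ac cd db.
    have := nnint_sqr_shift (ltW cd) mpsi psi0 k0.
    have := nnint_sqr_shift (ltW cd) mpsi psi0 (@ler01 R).
    have := nnint_ge0 `]c, d[ (fun x => sqr_ge0 (psi x - k)).
    have := nnint_ge0 `]c, d[ (fun x => sqr_ge0 (psi x - 1)).
    have := nnint_ge0 `]c, d[ (fun x => sqr_ge0 (psi x)).
    rewrite E.
    move: Hk.
    move: (\int[mu]_(x in `]c, d[) ((psi x - k)^+2)%:E)%E => u.
    move: (\int[mu]_(x in `]c, d[) ((psi x - 1)^+2)%:E)%E => v.
    move: (\int[mu]_(x in `]c, d[) ((psi x)^+2)%:E)%E => w.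
    rewrite -!EFinM; case: u => [u| |]//.
    case: w => [w| |]; rewrite ?addye//.
    case: v => [v| |]; rewrite ?addye//.
    rewrite -!EFinD !lee_fin => ? ? ? ? [?] [?].
    have : 0 <= (k - 1)^+2 * (d - c) by rewrite mulr_ge0 ?sqr_ge0 ?subr_ge0 ?ltW.
    lra.
  - rewrite fsum// subr_le0 -lee_fin fineK ?psifin//.
rewrite /rms_le fsq// expr1n nnint_cst_oo ?(ltW ab)// mul1r.
have := nnint_sqr_shift (ltW ab) mpsi psi0 (@ler01 R).
rewrite mulr1 expr1n mul1r => E H.
by rewrite -(@leeD2rE _ (b - a)%:E)// -E addeC leeD2l.
Qed.
End small_mean.

(** * Exponential decay of the second moment of the excess *)

(** A discrete form of G' <= - G: iterating n + 1 steps of length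
    h = t / (n + 1) gives (1 + h)^(n + 1) G(t) <= G(0), and 1 + h >= e^(h - h^2). *)
Lemma exp_decay (R : realType) (G : R -> R) (t : R) : 0 <= t -> 0 <= G t ->
  (forall s u, 0 <= s -> s <= u -> (1 + (u - s)) * G u <= G s) ->
  G t <= expR (- t) * G 0.
Proof.
move=> t0 G_ge0 step.
have main n : G t <= expR (t ^+ 2 * n.+1%:R^-1 - t) * G 0.
  pose h := t / n.+1%:R.
  have h0 : 0 <= h by rewrite divr_ge0.
  have iterG k : (1 + h) ^+ k * G (k%:R * h) <= G 0.
    elim: k => [|k IH]; first by rewrite mul0r expr0 mul1r.
    apply: le_trans IH; rewrite exprSr -mulrA ler_wpM2l ?exprn_ge0 ?addr_ge0//.
    have := step (k%:R * h) (k.+1%:R * h); rewrite -natr1 mulrDl mul1r.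
    rewrite mulr_ge0// lerDl h0 => /(_ isT isT).
    by rewrite [_ + h - _]addrAC subrr add0r.
  have := iterG n.+1; rewrite [_ * h]mulrC divfK ?pnatr_eq0// => Gt.
  have eh : expR (h - h ^+ 2) <= 1 + h.
    have e0 := expR_gt0 (h ^+2 - h); have e1 := expR_ge1Dx (h ^+2 - h).
    have -> : expR (h - h ^+ 2) = (expR (h ^+ 2 - h))^-1 by rewrite -expRN opprB.
    have h2 : 0 <= h ^+ 2 by rewrite sqr_ge0.
    rewrite invf_ple ?posrE//; last by lra.
    apply: le_trans e1; rewrite -(mulr1 (1 + h)^-1) ler_pdivrMl; last by lra.
    have : 0 <= h ^+ 3 by rewrite exprn_ge0.
    by rewrite !exprS !expr0; lra.
  have {}eh : expR (t - t ^+ 2 / n.+1%:R) <= (1 + h) ^+ n.+1.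
    apply: le_trans (_ : expR (h - h ^+ 2) ^+ n.+1 <= _).
      rewrite -expRM_natl ler_expR /h.
      rewrite le_eqVlt; apply/orP; left; apply/eqP; field.
      by apply: lt0r_neq0; have := ler0n R n; lra.
    by apply: lerXn2r; rewrite ?nnegrE ?expR_ge0// addr_ge0.
  have -> : t ^+ 2 / n.+1%:R - t = - (t - t ^+ 2 / n.+1%:R) by rewrite opprB.
  rewrite expRN mulrC ler_pdivlMr ?expR_gt0// mulrC.
  by apply: le_trans Gt; exact: ler_wpM2r.
have cv : expR (t ^+ 2 * n.+1%:R^-1 - t) * G 0 @[n --> \oo] -->
  expR (t ^+ 2 * 0 - t) * G 0.
  apply: cvgM; last exact: cvg_cst.
  apply: continuous_cvg; first exact: continuous_expR.
  apply: cvgB; last exact: cvg_cst.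
  by apply: cvgM; [exact: cvg_cst|exact: cvg_harmonic].
rewrite mulr0 sub0r in cv.
apply: (ler_cvg_to (cvg_cst _) cv).
by apply: nearW => n; exact: main.
Qed.

Definition excess (R : realType) (X : R -> R) (t x : R) : R := Num.max (X x - t) 0.

Section excess_decay.
Context {R : realType}.
Notation mu := (@lebesgue_measure R).
Variables (phi : R -> R) (a b m : R).
Hypotheses (ab : a < b) (mphi : measurable_fun setT phi).
Hypothesis osc : forall c d, a <= c -> c < d -> d <= b -> exists k : R,
  (\int[mu]_(x in `]c, d[) ((phi x - k)^+2)%:E <= (d - c)%:E)%E.
Hypothesis oscm : (\int[mu]_(x in `]a, b[) ((phi x - m)^+2)%:E <= (b - a)%:E)%E.

Let X x := `|phi x - m|.
Let psi := excess X.
Let G t := (\int[mu]_(x in `]a, b[) ((psi t x)^+2)%:E)%E.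

Let mX : measurable_fun setT X.
Proof. by apply: measurableT_comp => //; exact: measurable_funB. Qed.

Let mpsi t : measurable_fun setT (psi t).
Proof. by apply: measurable_maxr => //; exact: measurable_funB. Qed.

Let psi_ge0 t x : 0 <= psi t x. Proof. by rewrite /psi /excess le_max lexx orbT.
  Qed.

(** The excess is a 1-Lipschitz function of phi, so that its oscillations are
    at most those of phi; its mean is at most that of X <= (X^2 + 1) / 2, hence
    at most 1. *)
Lemma excess_sqr_le t : 0 <= t ->
  (\int[mu]_(x in `]a, b[) ((excess X t x)^+2)%:E <=
   2%:E * \int[mu]_(x in `]a, b[) (excess X t x)%:E)%E.
Proof.
move=> t0; apply: (sqr_le_of_mean_le1 (psi := excess X t)) => //.
- move=> c d ac cd db; have [k Hk] := osc ac cd db.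
  exists (Num.max (`|k - m| - t) 0); first by rewrite le_max lexx orbT.
  apply: le_trans Hk; apply: le_nnint => //.
  + by apply: measurable_funX; apply: measurable_funB => //.
  + by apply: measurable_funX; exact: measurable_funB.
  move=> x _; rewrite sqr_ge0/= -[leLHS]real_normK ?num_real//
    -[leRHS]real_normK ?num_real//.
  rewrite lerXn2r ?nnegrE// /excess /X.
  have := ler_dist_dist (phi x - m) (k - m).
  rewrite (_ : phi x - m - (k - m) = phi x - k); last by ring.
  move: (`|phi x - m|) (`|k - m|) (`|phi x - k|) (normr_ge0 (phi x - k)) =>
    p q r r0.
  rewrite !ler_norml => /andP[? ?].
  by case: (leP (p - t) 0); case: (leP (q - t) 0) => ? ?; apply/andP; split; lra.
- rewrite -(@lee_pmul2l _ 2%:E)// -nnintZ//.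
  apply: (@le_trans _ _ (\int[mu]_(x in `]a, b[) ((phi x - m)^+2 + cst 1 x)%:E)%E).
    apply: le_nnint => //.
    + by apply: measurable_funM => //.
    + by apply: measurable_funD => //; apply: measurable_funX;
      exact: measurable_funB.
    move=> x _; rewrite mulr_ge0 ?psi_ge0//=.
    have : psi t x <= X x.
      by rewrite /psi /excess ge_max /X normr_ge0 andbT; lra.
    rewrite -(@real_normK _ (phi x - m)) ?num_real// -/(X x) /psi => le1.
    have := sqr_ge0 (X x - 1); rewrite sqrrB expr1n; lra.
  rewrite nnintD; [|by []|by apply: measurable_funX; exact: measurable_funB|by []|
    by move=> x _; rewrite sqr_ge0|by []].
  rewrite nnint_cst_oo ?(ltW ab)// mul1r.
  have -> : (2%:E * (b - a)%:E = (b - a)%:E + (b - a)%:E)%E.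
    by rewrite -EFinM -EFinD; congr (_%:E); ring.
  exact: leeD2r.
Qed.

Let excess_sqr_fin t : 0 <= t -> G t \is a fin_num.
Proof.
move=> t0; rewrite ge0_fin_numE; last by apply: nnint_ge0 => x; rewrite sqr_ge0.
apply: le_lt_trans (ltry (b - a)); apply: le_trans oscm; apply: le_nnint => //.
- by apply: measurable_funX.
- by apply: measurable_funX; exact: measurable_funB.
move=> x _; rewrite sqr_ge0/= -(@real_normK _ (phi x - m)) ?num_real//.
by rewrite lerXn2r ?nnegrE ?psi_ge0// ge_max /X normr_ge0 andbT; lra.
Qed.

(** Pointwise, (X - s)_+^2 >= (X - u)_+^2 + 2 (u - s) (X - u)_+ for s <= u, and
    excess_sqr_le bounds the integral of (X - u)_+ below by that of its square. *)
Lemma excess_sqr_decay t : 0 <= t ->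
  (\int[mu]_(x in `]a, b[) ((excess X t x)^+2)%:E <=
   (expR (- t))%:E * \int[mu]_(x in `]a, b[) ((X x)^+2)%:E)%E.
Proof.
move=> t0.
have -> : (\int[mu]_(x in `]a, b[) ((X x)^+2)%:E = G 0)%E.
  apply: eq_integral => x _; rewrite /psi /excess subr0.
  by rewrite max_l// /X normr_ge0.
have fG s : 0 <= s -> G s = (fine (G s))%:E by move=> s0;
  rewrite fineK// excess_sqr_fin.
rewrite -[leLHS]/(G t) fG// (fG 0)// -EFinM lee_fin.
apply: (@exp_decay R (fun s => fine (G s))) => //.
  by apply: fine_ge0; apply: nnint_ge0 => x; rewrite sqr_ge0.
move=> s u s0 su.
have u0 := le_trans s0 su.
rewrite -lee_fin EFinM -fG// -fG// EFinD ge0_muleDl ?lee_fin ?subr_ge0//.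
rewrite mul1e.
apply: (@le_trans _ _ (G u + (u - s)%:E * (2%:E * \int[mu]_(x in `]a, b[)
  (psi u x)%:E))%E).
  by apply: leeD2l; apply: lee_wpmul2l; [rewrite lee_fin subr_ge0|exact:
    excess_sqr_le].
rewrite muleA -EFinM -nnintZ//; last by rewrite mulr_ge0// subr_ge0.
rewrite -nnintD; [|by []|by apply: measurable_funX|by apply: measurable_funM|
  by move=> x _; rewrite sqr_ge0|
  by move=> x _; rewrite !mulr_ge0 ?subr_ge0 ?psi_ge0].
apply: le_nnint => //.
- apply: measurable_funD; first by apply: measurable_funX.
  by apply: measurable_funM => //.
- by apply: measurable_funX.
move=> x _; rewrite addr_ge0 ?sqr_ge0 ?mulr_ge0 ?subr_ge0 ?psi_ge0//=.
rewrite /psi /excess; move: (X x) => y.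
case: (leP (y - u) 0) => yu; first by rewrite expr0n mulr0 addr0 sqr_ge0.
rewrite max_l; last by lra.
have : 0 <= (u - s)^+2 by rewrite sqr_ge0.
by rewrite !expr2; lra.
Qed.
End excess_decay.

(** * Integrals of powers *)

Section power_integrals.
Context {R : realType}.
Notation mu := (@lebesgue_measure R).

(** For integrands that may be unbounded at the left end: the integrals over
    ]u, b[ increase to the integral over ]a, b[ as u decreases to a. *)
Lemma ge0_FTC2_left (f F : R -> R) (a b l : R) : a < b ->
  (forall x, a < x -> 0 <= f x) -> (forall x, a < x -> {for x, continuous f}) ->
  (forall x, a < x -> is_derive x 1 F (f x)) -> F x @[x --> a^'+] --> l ->
  (\int[mu]_(x in `]a, b[) (f x)%:E = (F b - l)%:E)%E.
Proof.
move=> ab f0 cf dF Fl.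
pose u (n : nat) : R := a + (b - a) * n.+2%:R^-1.
have au n : a < u n by rewrite ltrDl mulr_gt0 ?subr_gt0 ?invr_gt0.
have ub n : u n < b.
  rewrite -ltrBrDl gtr_pMr ?subr_gt0// invf_lt1// ltr1n//.
have ua : u n @[n --> \oo] --> a.
  rewrite -[X in _ --> X]addr0; apply: cvgD; first exact: cvg_cst.
  rewrite -(mulr0 (b - a)); apply: cvgM; first exact: cvg_cst.
  have := @cvg_harmonic R; rewrite -cvg_shiftS; exact.
have derF x : a < x -> derivable F x 1 by move=> ax; have := dF x ax; case.
have cF x : a < x -> {for x, continuous F}.
  by move=> /derF/derivable1_diffP/differentiable_continuous.
have mf n : measurable_fun `]u n, b[%classic f.
  apply: open_continuous_measurable_fun; first exact: interval_open.
  by move=> x; rewrite inE/= in_itv/= => /andP[ux _]; apply: cf; exact: lt_trans ux.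
have In n : (\int[mu]_(x in `]u n, b[) (f x)%:E = (F b - F (u n))%:E)%E.
  rewrite -(@integral_itv_bndoo _ _ _ _ true false); last exact/measurable_EFinP.
  rewrite (@continuous_FTC2 _ f F)// ?EFinB//.
  - apply: continuous_in_subspaceT => x; rewrite inE/= in_itv/= => /andP[ux _].
    by apply: cf; exact: lt_le_trans ux.
  - split => [x||].
    + by rewrite in_itv/= => /andP[ux _]; apply: derF; exact: lt_trans ux.
    + by apply: cvg_at_right_filter; apply: cF.
    + by apply: cvg_at_left_filter; apply: cF.
  - move=> x; rewrite in_itv/= => /andP[ux _]; rewrite derive1E.
    by have [_ ->] := dF x (lt_trans (au n) ux).
have Eab : `]a, b[%classic = \bigcup_n `]u n, b[%classic.
  apply/seteqP; split => x /=.
    rewrite in_itv/= => /andP[ax xb].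
    have : \forall n \near \oo, u n < x by exact: (cvgr_lt a ua).
    move=> [n _ /(_ n (leqnn n)) Hn].
    by exists n => //=; rewrite in_itv/= Hn xb.
  move=> [n _] /=; rewrite !in_itv/= => /andP[ux ->]; rewrite andbT.
  exact: lt_trans ux.
have cv1 : (\int[mu]_(x in `]u n, b[) (f x)%:E)%E @[n --> \oo] -->
  (\int[mu]_(x in `]a, b[) (f x)%:E)%E.
  rewrite Eab; apply: ge0_nondecreasing_set_cvg_integral => //.
  - move=> n m nm; apply/subsetPset => x /=; rewrite !in_itv/= => /andP[ux ->].
    rewrite andbT; apply: le_lt_trans ux.
    rewrite lerD2l; apply: ler_wpM2l; first by rewrite subr_ge0 ltW.
    by rewrite lef_pV2 ?posrE// ler_nat.
  - move=> n; apply/measurable_EFinP; exact: mf.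
  - by move=> n x /=; rewrite in_itv/= => /andP[ux _];
    rewrite lee_fin f0// (lt_trans (au n)).
have cv2 : (\int[mu]_(x in `]u n, b[) (f x)%:E)%E @[n --> \oo] --> (F b - l)%:E.
  under eq_fun do rewrite In.
  apply: cvg_EFin; first by near=> n.
  apply: cvgB; first exact: cvg_cst.
  by move/cvg_at_rightP : Fl; apply.
by rewrite -(cvg_lim _ cv1)// (cvg_lim _ cv2).
Unshelve. all: by end_near. Qed.

Lemma continuous_powR_gt0 (q x : R) : 0 < x ->
  {for x, continuous (fun y : R => y `^ q)}.
Proof.
move=> x0; apply: differentiable_continuous; apply/derivable1_diffP.
by have [] := is_derive1_powR q x0.
Qed.

Lemma integral_powR_left (q u : R) : 0 < q -> 0 <= u ->
  (\int[mu]_(t in `]0%R, u[) (t `^ (q - 1))%:E = (u `^ q / q)%:E)%E.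
Proof.
move=> q0; rewrite le_eqVlt => /predU1P[<-|u0].
  by rewrite set_itvoo0 integral_set0 powR0 ?gt_eqF// mul0r.
transitivity ((q^-1 * u `^ q - 0)%:E); last by rewrite subr0 mulrC.
apply: (@ge0_FTC2_left _ (fun x => q^-1 * x `^ q)) => //.
- by move=> x x0; rewrite powR_ge0.
- by move=> x x0; exact: continuous_powR_gt0.
- move=> x x0.
  have D := is_derive1_powR q x0.
  have -> : x `^ (q - 1) = q^-1 *: (q * x `^ (q - 1)).
    by rewrite -[_ *: _]/(_ * _) mulKf// gt_eqF.
  exact: is_deriveZ.
- by rewrite -[X in _ --> X](mulr0 q^-1); apply: cvgM;
  [exact: cvg_cst|exact: powR_cvg0].
Qed.

Lemma cvg_powRN_pinfty (r : R) : 0 < r -> x `^ (- r) @[x --> +oo] --> 0.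
Proof.
move=> r0.
apply/cvgrPdist_lt => e e0; near=> x.
have x0 : 0 < x by near: x; exact: nbhs_pinfty_gt.
rewrite sub0r normrN ger0_norm ?powR_ge0// powRN.
rewrite invf_plt ?posrE ?powR_gt0//.
have : (e^-1 `^ r^-1) < x by near: x; apply: nbhs_pinfty_gt; rewrite num_real.
move=> /(gt0_ltr_powR r0); rewrite !nnegrE powR_ge0 (ltW x0) => /(_ isT isT).
by rewrite -powRrM mulVf ?gt_eqF// powRr1// invr_ge0 ltW.
Unshelve. all: by end_near. Qed.

Lemma integral_powR_right (r u : R) : 0 < r -> 0 < u ->
  (\int[mu]_(t in `[u, +oo[) (t `^ (- r - 1))%:E = (u `^ (- r) / r)%:E)%E.
Proof.
move=> r0 u0.
have D (x : R) : 0 < x -> is_derive x 1 (fun x : R => - r^-1 * x `^ (- r)) (x `^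
  (- r - 1)).
  move=> x0; have D := is_derive1_powR (- r) x0.
  have -> : x `^ (- r - 1) = - r^-1 *: (- r * x `^ (- r - 1)).
    by rewrite -[_ *: _]/(_ * _) mulrA mulrNN mulVf ?mul1r// gt_eqF.
  exact: is_deriveZ.
transitivity (0%:E - (- r^-1 * u `^ (- r))%:E)%E; last first.
  by rewrite -EFinB sub0r mulNr opprK mulrC.
apply: (@ge0_continuous_FTC2y _ _ (fun x => - r^-1 * x `^ (- r))).
- by move=> x _; rewrite powR_ge0.
- apply: continuous_in_subspaceT => x; rewrite inE/= in_itv/= andbT => ux.
  by apply: continuous_powR_gt0; exact: lt_le_trans ux.
- rewrite -[X in _ --> X](mulr0 (- r^-1)); apply: cvgM; first exact: cvg_cst.
  exact: cvg_powRN_pinfty.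
- by move=> x ux; have [] := D x (lt_trans u0 ux).
- apply: cvg_at_right_filter; have [+ _] := D u u0.
  by move=> /derivable1_diffP/differentiable_continuous.
- move=> x; rewrite in_itv/= andbT => ux; rewrite derive1E.
  by have [_ ->] := D x (lt_trans u0 ux).
Qed.
End power_integrals.

(** * Powers as superpositions of truncated squares *)

Section kernels.
Context {R : realType}.
Notation mu := (@lebesgue_measure R).

Lemma tonelli_on (A B : set R) (f : R * R -> R) : measurable A -> measurable B ->
  measurable_fun setT f -> (forall x y, A x -> B y -> 0 <= f (x, y)) ->
  (\int[mu]_(x in A) \int[mu]_(y in B) (f (x, y))%:E =
   \int[mu]_(y in B) \int[mu]_(x in A) (f (x, y))%:E)%E.
Proof.
move=> mA mB mf f0.
pose g (p : R * R) := f p * (\1_A p.1 * \1_B p.2).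
have gE x y : g (x, y) = if (x \in A) && (y \in B) then f (x, y) else 0.
  by rewrite /g /= !indicE; case: (x \in A); case: (y \in B);
    rewrite /= ?(mulr0, mul0r, mulr1).
have mg : measurable_fun setT (EFin \o g).
  apply/measurable_EFinP; apply: measurable_funM => //.
  by apply: measurable_funM; apply: measurableT_comp => //; exact: measurable_indic.
have g0 p : (0 <= (EFin \o g) p)%E.
  case: p => x y; rewrite /= gE; case: ifPn => // /andP[].
  by rewrite !inE lee_fin; exact: f0.
have := @fubini_tonelli _ _ _ _ R mu mu (EFin \o g) mg g0.
have -> : (\int[mu]_(x in A) \int[mu]_(y in B) (f (x, y))%:E =
           \int[mu]_x \int[mu]_y (EFin \o g) (x, y))%E.
  rewrite integral_mkcond; apply: eq_integral => x _; rewrite patchE.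
  case: ifPn => xA.
    rewrite integral_mkcond; apply: eq_integral => y _; rewrite patchE /= gE xA.
    by case: ifPn.
  by rewrite integral0_eq// => y _; rewrite /= gE (negbTE xA).
have -> : (\int[mu]_(y in B) \int[mu]_(x in A) (f (x, y))%:E =
           \int[mu]_y \int[mu]_x (EFin \o g) (x, y))%E.
  rewrite integral_mkcond; apply: eq_integral => y _; rewrite patchE.
  case: ifPn => yB.
    rewrite integral_mkcond; apply: eq_integral => x _;
      rewrite patchE /= gE yB andbT.
    by case: ifPn.
  by rewrite integral0_eq// => x _; rewrite /= gE (negbTE yB) andbF.
exact.
Qed.

Lemma integral_lt_ray (g : R -> R) (u : R) :
  (\int[mu]_(t in `]0%R, +oo[) (if t < u then g t else 0)%:E =
   \int[mu]_(t in `]0%R, u[) (g t)%:E)%E.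
Proof.
rewrite integral_mkcond [RHS]integral_mkcond; apply: eq_integral => t _.
rewrite !patchE !mem_setE !in_itv/= andbT.
by case: (0 < t) => //=; case: (t < u).
Qed.


Lemma powR_succ (t q : R) : 0 < t -> t `^ (q + 1) = t * t `^ q.
Proof.
move=> t0; rewrite powRD; last by rewrite (gt_eqF t0) implybT.
by rewrite powRr1 ?(ltW t0)// mulrC.
Qed.


(** u^p is the integral of p t^(p-1) over 0 < t < u. *)
Lemma layer_cake (A : set R) (X : R -> R) (p : R) : 0 < p -> measurable A ->
  measurable_fun setT X -> (forall x, A x -> 0 <= X x) ->
  (\int[mu]_(x in A) (X x `^ p)%:E =
   \int[mu]_(t in `]0%R, +oo[) ((p * t `^ (p - 1))%:E * mu (A `&` [set x |
     (t < X x)%R])))%E.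
Proof.
move=> p0 mA mX X0.
pose f (q : R * R) : R := if q.2 < X q.1 then p * q.2 `^ (p - 1) else 0.
have mlt : measurable_fun setT (fun q : R * R => q.2 < X q.1).
  by apply: measurable_fun_ltr => //; exact: measurableT_comp.
have mf : measurable_fun setT f.
  apply: measurable_fun_ifT => //; apply: measurable_funM => //.
  by apply: (@measurableT_comp _ _ _ _ _ _ (@powR R ^~ (p - 1))) => //;
    exact: measurable_powR.
have f0 x y : A x -> `]0, +oo[%classic y -> 0 <= f (x, y).
  by move=> _ _; rewrite /f; case: ifPn => // _; rewrite mulr_ge0 ?powR_ge0 ?ltW.
have := @tonelli_on A `]0, +oo[%classic f mA _ mf f0.
move=> /(_ (measurable_itv _)) E.
transitivity (\int[mu]_(x in A) \int[mu]_(y in `]0%R, +oo[) (f (x, y))%:E)%E.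
  apply: eq_integral => x; rewrite inE => Ax; rewrite /f/= integral_lt_ray.
  rewrite (nnintZ (f := fun t => t `^ (p - 1)) (measurable_itv _)
    (measurable_powR _) (fun _ _ => powR_ge0 _ _) (ltW p0)).
  rewrite (integral_powR_left p0 (X0 x Ax)) -EFinM mulrCA divff;
    last exact: lt0r_neq0.
  by rewrite mulr1.
rewrite E; apply: eq_integral => t _.
have mS : measurable [set x | t < X x].
  have := measurable_fun_ltr (measurable_cst t) mX measurableT.
  by move=> /(_ [set true] I); rewrite setTI.
rewrite (_ : (\int[mu]_(x in A) (f (x, t))%:E)%E =
  (\int[mu]_(x in A) ((p * t `^ (p - 1)) * \1_[set x | (t < X x)%R] x)%:E)%E);
    last first.
  apply: eq_integral => x _; rewrite /f /= indicE; congr (_%:E).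
  have -> : (x \in [set x | t < X x]) = (t < X x) by apply/idP/idP; rewrite inE.
  by case: (t < X x); rewrite /= ?(mulr1, mulr0).
have w0 : 0 <= p * t `^ (p - 1) by exact: mulr_ge0 (ltW p0) (powR_ge0 _ _).
rewrite (nnintZ mA (measurable_indic mS) _ w0); last by move=> x _; rewrite indicE.
rewrite integral_indic; [|exact: mA|exact: mS].
by rewrite setIC.
Qed.

(** The integral of t^(p-3) (1 - t)_+^2 over t > 0. *)
Definition kerA (p : R) : R := (p - 2)^-1 - 2 / (p - 1) + p^-1.

Lemma kerA_gt0 (p : R) : 2 < p -> 0 < kerA p.
Proof.
move=> p2; rewrite /kerA.
have -> : (p - 2)^-1 - 2 / (p - 1) + p^-1 = 2 / (p * (p - 1) * (p - 2)).
  by field; apply/and3P; split; apply/negP => /eqP; lra.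
by rewrite divr_gt0// !mulr_gt0//; lra.
Qed.

Lemma integral_kerA (p u : R) : 2 < p -> 0 <= u ->
  (\int[mu]_(t in `]0%R, +oo[) (t `^ (p - 3) * (Num.max (u - t) 0)^+2)%:E =
   (kerA p * u `^ p)%:E)%E.
Proof.
move=> p2 u0.
transitivity (\int[mu]_(t in `]0%R, u[) (t `^ (p - 3) * (u - t)^+2)%:E)%E.
  rewrite -integral_lt_ray; apply: eq_integral => t _.
  case: ltP => tu; first by rewrite max_l// subr_ge0 ltW.
  by rewrite max_r ?subr_le0// expr0n mulr0.
have [p1 p2' p0] : [/\ 0 < p - 1, 0 < p - 2 & 0 < p] by split; lra.
move: u0; rewrite le_eqVlt => /predU1P[<-|u0].
  by rewrite set_itvoo0 integral_set0 powR0 ?mulr0// gt_eqF.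
have mpow q : measurable_fun setT (fun t : R => t `^ q) by exact: measurable_powR.
have msub : measurable_fun setT (fun t : R => (u - t)^+2).
  by apply: measurable_funX; exact: measurable_funB.
have : (\int[mu]_(t in `]0%R, u[) (t `^ (p - 3) * (u - t)^+2)%:E +
        \int[mu]_(t in `]0%R, u[) ((2 * u) * t `^ (p - 1 - 1))%:E =
        \int[mu]_(t in `]0%R, u[) (u^+2 * t `^ (p - 2 - 1))%:E +
        \int[mu]_(t in `]0%R, u[) (t `^ (p - 1))%:E)%E.
  have m2 : measurable_fun setT (fun t : R => 2 * u * t `^ (p - 1 - 1))
    by exact: measurable_funM.
  have m1 : measurable_fun setT (fun t : R => t `^ (p - 3) * (u - t)^+2)
    by exact: measurable_funM.
  have m3 : measurable_fun setT (fun t : R => u^+2 * t `^ (p - 2 - 1))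
    by exact: measurable_funM.
  rewrite -(nnintD (measurable_itv _) m1 m2); first last.
  - by move=> t _; rewrite mulr_ge0 ?powR_ge0//; lra.
  - by move=> t _; rewrite mulr_ge0 ?powR_ge0 ?sqr_ge0.
  rewrite -(nnintD (measurable_itv _) m3 (mpow _)); first last.
  - by move=> t _; rewrite powR_ge0.
  - by move=> t _; rewrite mulr_ge0 ?powR_ge0 ?sqr_ge0.
  apply: eq_integral => t; rewrite inE/= in_itv/= => /andP[t0 tu]; congr (_%:E).
  have e1 : t `^ (p - 1 - 1) = t * t `^ (p - 3).
    by rewrite -powR_succ//; congr (_ `^ _); ring.
  have e2 : t `^ (p - 1) = t * (t * t `^ (p - 3)).
    by rewrite -!powR_succ//; congr (_ `^ _); ring.
  have e3 : t `^ (p - 2 - 1) = t `^ (p - 3) by congr (_ `^ _); ring.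
  by rewrite e1 e3 e2; ring.
have u2 : 0 <= u^+2 by rewrite sqr_ge0.
have uu : 0 <= 2 * u by rewrite mulr_ge0 ?ltW.
have pow0 q t : `]0%R, u[%classic t -> 0 <= t `^ q by rewrite powR_ge0.
rewrite (nnintZ (measurable_itv _) (mpow (p - 1 - 1)) (pow0 _) uu).
rewrite (nnintZ (measurable_itv _) (mpow (p - 2 - 1)) (pow0 _) u2).
rewrite (integral_powR_left p0 (ltW u0)) (integral_powR_left p1 (ltW u0)).
rewrite (integral_powR_left p2' (ltW u0)).
move: (\int[mu]_(t in _) _)%E => [k| |]//; rewrite -!EFinM -!EFinD => -[E].
congr (_%:E); move: E; rewrite /kerA.
have -> : u `^ (p - 1) = u * u `^ (p - 2).
  by rewrite -powR_succ//; congr (_ `^ _); ring.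
have -> : u `^ p = u * (u * u `^ (p - 2)).
  by rewrite -!powR_succ//; congr (_ `^ _); ring.
lra.
Qed.

End kernels.

Section kernels2.
Context {R : realType}.
Notation mu := (@lebesgue_measure R).

(** The integral of t^(p-3) (1 - (1 - t)_+^2) over t > 0: it converges at 0 if
    p > 1, and at infinity if p < 2. *)
Definition kerB (p : R) : R := 2 / (p - 1) - p^-1 + (2 - p)^-1.

Lemma kerB_gt0 (p : R) : 1 < p -> p < 2 -> 0 < kerB p.
Proof.
move=> p1 p2; rewrite /kerB.
have -> : 2 / (p - 1) - p^-1 = (p + 1) / (p * (p - 1)).
  by field; apply/andP; split; apply/negP => /eqP; lra.
have ? : 0 < (p + 1) / (p * (p - 1)) by rewrite divr_gt0 ?mulr_gt0//; lra.
have ? : 0 < (2 - p)^-1 by rewrite invr_gt0; lra.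
lra.
Qed.

Lemma integral_kerB (p u : R) : 1 < p -> p < 2 -> 0 <= u ->
  (\int[mu]_(t in `]0%R, +oo[) (t `^ (p - 3) * (u^+2 - (Num.max (u - t) 0)^+2))%:E =
   (kerB p * u `^ p)%:E)%E.
Proof.
move=> p1 p2.
have [p1' p2' p0] : [/\ 0 < p - 1, 0 < 2 - p & 0 < p] by split; lra.
rewrite le_eqVlt => /predU1P[<-|u0].
  rewrite powR0 ?gt_eqF// mulr0 integral0_eq// => t;
    rewrite /= in_itv/= andbT => t0.
  by rewrite max_r; [rewrite expr0n subrr mulr0|rewrite sub0r oppr_le0 ltW].
have mpow q : measurable_fun setT (fun t : R => t `^ q) by exact: measurable_powR.
have mmax : measurable_fun setT (fun t : R => (Num.max (u - t) 0)^+2).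
  by apply: measurable_funX; apply: measurable_maxr => //; exact: measurable_funB.
have mker : measurable_fun setT (fun t : R => t `^ (p - 3) * (u^+2 - (Num.max
  (u - t) 0)^+2)).
  by apply: measurable_funM => //; exact: measurable_funB.
have pow0 q (S : set R) t : S t -> 0 <= t `^ q by rewrite powR_ge0.
have ker0 t : 0 <= t -> 0 <= t `^ (p - 3) * (u^+2 - (Num.max (u - t) 0)^+2).
  move=> t0; apply: mulr_ge0; first exact: powR_ge0.
  rewrite subr_ge0; apply: lerXn2r; rewrite ?nnegrE ?le_max ?lexx ?orbT ?(ltW u0)//.
  by rewrite ge_max (ltW u0) andbT; lra.
rewrite (@itv_bndbnd_setU _ _ _ (BLeft u)) ?bnd_simp//.
rewrite ge0_integral_setU; [|exact: measurable_itv|exact: measurable_itv| | |];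
  first last.
- by apply/disj_setPS => x []/=; rewrite !in_itv/=; lra.
- by move=> x [|]/=; rewrite !in_itv/= ?andbT => H; rewrite lee_fin;
  apply: ker0; lra.
- by apply/measurable_EFinP; exact: measurable_funTS.
have -> : (\int[mu]_(t in `[u, +oo[) (t `^ (p - 3) * (u^+2 - (Num.max (u - t)
  0)^+2))%:E =
    ((2 - p)^-1 * u `^ p)%:E)%E.
  transitivity (\int[mu]_(t in `[u, +oo[) (u^+2 * t `^ (- (2 - p) - 1))%:E)%E.
    apply: eq_integral => t; rewrite inE/= in_itv/= andbT => ut.
    rewrite max_r ?subr_le0// expr0n subr0 mulrC; congr (_ * _ `^ _)%:E; ring.
  rewrite (nnintZ (measurable_itv _) (mpow _) (pow0 _ _) (sqr_ge0 u)).
  rewrite (integral_powR_right p2' u0) -EFinM; congr (_%:E).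
  have -> : u `^ p = u * (u * u `^ (- (2 - p))).
    by rewrite -!powR_succ//; congr (_ `^ _); ring.
  by rewrite expr2; ring.
have uu : 0 <= 2 * u by rewrite mulr_ge0 ?ltW.
have : (\int[mu]_(t in `]0%R, u[) (t `^ (p - 3) * (u^+2 - (Num.max (u - t)
  0)^+2))%:E +
        \int[mu]_(t in `]0%R, u[) (t `^ (p - 1))%:E =
        \int[mu]_(t in `]0%R, u[) ((2 * u) * t `^ (p - 1 - 1))%:E)%E.
  rewrite -(nnintD (measurable_itv _) mker (mpow _) _ (pow0 _ _)); last first.
    by move=> t /=; rewrite in_itv/= => /andP[t0 _]; apply: ker0; exact: ltW.
  apply: eq_integral => t; rewrite inE/= in_itv/= => /andP[t0 tu]; congr (_%:E).
  have e1 : t `^ (p - 1 - 1) = t * t `^ (p - 3).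
    by rewrite -powR_succ//; congr (_ `^ _); ring.
  have e2 : t `^ (p - 1) = t * (t * t `^ (p - 3)).
    by rewrite -!powR_succ//; congr (_ `^ _); ring.
  by rewrite e1 e2 max_l ?subr_ge0 ?(ltW tu)//; ring.
rewrite (nnintZ (measurable_itv _) (mpow _) (pow0 _ _) uu).
rewrite (integral_powR_left p0 (ltW u0)) (integral_powR_left p1' (ltW u0)).
move: (\int[mu]_(t in _) _)%E => [k| |]//; rewrite -!EFinM -!EFinD => -[E].
congr (_%:E); move: E; rewrite /kerB.
have -> : u `^ p = u * u `^ (p - 1).
  by rewrite -powR_succ//; congr (_ `^ _); ring.
lra.
Qed.

(** Yields the second moment of an exponential variable from the first one. *)
Lemma integral_ker1 (u : R) : 0 <= u ->
  (\int[mu]_(t in `]0%R, +oo[) (2 * Num.max (u - t) 0)%:E = (1 * u `^ 2)%:E)%E.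
Proof.
move=> u0.
transitivity (\int[mu]_(t in `]0%R, u[) (2 * (u - t))%:E)%E.
  rewrite -integral_lt_ray; apply: eq_integral => t _.
  case: ltP => tu; first by rewrite max_l// subr_ge0 ltW.
  by rewrite max_r ?subr_le0// mulr0.
have mpow q : measurable_fun setT (fun t : R => t `^ q) by exact: measurable_powR.
have m1 : measurable_fun setT (fun t : R => 2 * (u - t)).
  by apply: measurable_funM => //; exact: measurable_funB.
have m2 : measurable_fun setT (fun t : R => 2 * t `^ (2 - 1)).
  by apply: measurable_funM => //; exact: mpow.
have pow0 q (S : set R) t : S t -> 0 <= t `^ q by rewrite powR_ge0.
have : (\int[mu]_(t in `]0%R, u[) (2 * (u - t))%:E +
        \int[mu]_(t in `]0%R, u[) (2 * t `^ (2 - 1))%:E =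
        \int[mu]_(t in `]0%R, u[) (2 * u)%:E)%E.
  rewrite -(nnintD (measurable_itv _) m1 m2); first last.
  - by move=> t _; rewrite mulr_ge0 ?powR_ge0.
  - by move=> t /=; rewrite in_itv/= => /andP[t0 tu]; lra.
  apply: eq_integral => t; rewrite inE/= in_itv/= => /andP[t0 tu]; congr (_%:E).
  have -> : (2 : R) - 1 = 1 by lra.
  rewrite powRr1 ?ltW//; lra.
rewrite (nnint_cst_oo _ u0) (nnintZ (measurable_itv _) (mpow _) (pow0 _ _)
  (ler0n _ 2)).
rewrite (integral_powR_left (ltr0Sn _ 1) u0).
move: (\int[mu]_(t in _) _)%E => [k| |]//; rewrite -!EFinM -!EFinD => -[E].
congr (_%:E); move: E.
have -> : u `^ 2 = u * u by rewrite -expr2 (@powR_mulrn _ _ 2).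
lra.
Qed.

Lemma tonelli_kernel (A : set R) (X : R -> R) (N : R * R -> R) (k p : R) :
  measurable A -> measurable_fun setT X -> (forall x, A x -> 0 <= X x) ->
  measurable_fun setT N -> (forall t u, 0 < t -> 0 <= u -> 0 <= N (t, u)) ->
    0 <= k ->
  (forall u, 0 <= u -> (\int[mu]_(t in `]0%R, +oo[) (N (t, u))%:E =
    (k * u `^ p)%:E)%E) ->
  (k%:E * \int[mu]_(x in A) (X x `^ p)%:E =
   \int[mu]_(t in `]0%R, +oo[) \int[mu]_(x in A) (N (t, X x))%:E)%E.
Proof.
move=> mA mX X0 mN N0 k0 NE.
have mXp : measurable_fun setT (fun x => X x `^ p).
  by apply: (measurableT_comp (@measurable_powR R p)).
have Xp0 x : A x -> 0 <= X x `^ p by rewrite powR_ge0.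
rewrite -(nnintZ mA mXp Xp0 k0).
pose f (q : R * R) : R := N (q.2, X q.1).
have mf : measurable_fun setT f.
  apply: measurableT_comp mN _; apply/measurable_fun_pairP; split => /=.
    exact: measurable_snd.
  by apply: (measurableT_comp mX); exact: measurable_fst.
rewrite -(tonelli_on mA (measurable_itv `]0, +oo[) mf).
- by apply: eq_integral => x; rewrite inE => Ax; rewrite /f/= (NE _ (X0 x Ax)).
- by move=> x t Ax /=; rewrite in_itv/= andbT => t0; rewrite /f;
  apply: N0 => //; exact: X0.
Qed.
End kernels2.

(** * Moments of exponential variables *)

Section exponential_moments.
Context {R : realType}.
Notation mu := (@lebesgue_measure R).

(** The p-th moment of an exponential variable, written through its tail e^-t;
    it is equal to p Gamma(p) (expmomE). *)
Definition expmom (p : R) : \bar R :=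
  (\int[mu]_(t in `]0%R, +oo[) ((p * t `^ (p - 1)) * expR (- t))%:E)%E.

Let mpow q : measurable_fun setT (fun t : R => t `^ q).
Proof. exact: measurable_powR. Qed.

Let mexpN : measurable_fun setT (fun t : R => expR (- t)).
Proof. by apply: measurableT_comp => //; exact: measurable_expR. Qed.

Let mdens p : measurable_fun setT (fun t : R => (p * t `^ (p - 1)) * expR (- t)).
Proof. by apply: measurable_funM => //; apply: measurable_funM. Qed.

Let dens0 p (S : set R) t : 0 < p -> S t -> 0 <= (p * t `^ (p - 1)) * expR (- t).
Proof.
by move=> p0 _; apply: mulr_ge0; [apply: mulr_ge0;
  [exact: ltW|exact: powR_ge0]|exact: expR_ge0].
Qed.

(** By the layer cake formula, moments depend only on the tail. *)
Lemma exp_tail_moment (A : set R) (Y : R -> R) (C p : R) : 0 < p -> 0 <= C ->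
  measurable A -> measurable_fun setT Y -> (forall x, A x -> 0 <= Y x) ->
  (forall t, 0 < t -> mu (A `&` [set x | t < Y x]) = (C * expR (- t))%:E) ->
  (\int[mu]_(x in A) (Y x `^ p)%:E = C%:E * expmom p)%E.
Proof.
move=> p0 C0 mA mY Y0 tail.
rewrite (layer_cake p0 mA mY Y0) /expmom.
rewrite -(nnintZ (measurable_itv _) (mdens p) (fun t S => dens0 p0 S) C0).
apply: eq_integral => t; rewrite inE/= in_itv/= andbT => t0.
by rewrite (tail t t0) -EFinM; congr (_%:E); ring.
Qed.

(** The excess over s of the exponential variable - ln x, x in ]0, 1[; by
    absence of memory it has the tail e^-s e^-t. *)
Definition expvar (s x : R) : R := Num.max (- ln x - s) 0.

Lemma measurable_expvar s : measurable_fun setT (expvar s).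
Proof.
apply: measurable_maxr => //; apply: measurable_funB => //.
by apply: measurableT_comp => //; exact: measurable_ln.
Qed.

Lemma expvar_ge0 s x : 0 <= expvar s x. Proof. by rewrite le_max lexx orbT. Qed.

Lemma expvar_moment (s p : R) : 0 < p -> 0 <= s ->
  (\int[mu]_(x in `]0%R, 1%R[) (expvar s x `^ p)%:E = (expR (- s))%:E * expmom p)%E.
Proof.
move=> p0 s0.
apply: (exp_tail_moment p0 (expR_ge0 _) (measurable_itv _) (measurable_expvar s)).
  by move=> x _; exact: expvar_ge0.
move=> t t0.
have e1 : expR (- (s + t)) < 1 by rewrite expR_lt1; lra.
have -> : `]0%R, 1%R[ `&` [set x | t < expvar s x] = `]0, expR (- (s + t))[%classic.
  apply/seteqP; split => x /=; rewrite !in_itv/=.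
    move=> [/andP[x0 x1]]; rewrite lt_max (ltNge t 0) (ltW t0) orbF x0/= => tx.
    by rewrite -ltr_ln ?posrE ?expR_gt0// expRK; lra.
  move=> /andP[x0 xe]; rewrite x0 (lt_trans xe)//; split => //.
  move: xe; rewrite -ltr_ln ?posrE ?expR_gt0// expRK => xe.
  by rewrite lt_max; apply/orP; left; lra.
rewrite lebesgue_measure_itv/= lte_fin expR_gt0 oppr0 adde0.
by rewrite -expRD; congr (expR _)%:E; ring.
Qed.

Lemma expmom_expvar (p : R) : 0 < p ->
  expmom p = (\int[mu]_(x in `]0%R, 1%R[) (expvar 0 x `^ p)%:E)%E.
Proof. by move=> p0; rewrite expvar_moment// oppr0 expR0 mul1e. Qed.

(** The logarithm is smaller than any power: - ln x <= 2 p x^(-1/(2p)), whose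
    p-th power is integrable on ]0, 1[. *)
Lemma expmom_lty (p : R) : 0 < p -> (expmom p < +oo)%E.
Proof.
move=> p0; rewrite expmom_expvar//.
pose q := (2 * p)^-1.
have q0 : 0 < q by rewrite invr_gt0 mulr_gt0.
apply: (@le_lt_trans _ _ (\int[mu]_(x in `]0%R, 1%R[) ((q^-1) `^ p * x `^
  (2^-1 - 1))%:E)%E).
  apply: le_nnint => //.
  - by apply: (measurableT_comp (@measurable_powR R p)); exact: measurable_expvar.
  - by apply: measurable_funM.
  move=> x /=; rewrite in_itv/= => /andP[x0 x1]; rewrite powR_ge0/=.
  have le1 : expvar 0 x <= q^-1 * x `^ (- q).
    rewrite /expvar subr0 ge_max; apply/andP; split; last first.
      by rewrite mulr_ge0 ?powR_ge0// invr_ge0 ltW.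
    rewrite ler_pdivlMl//.
    have := ln_sublinear (powR_gt0 (- q) x0); rewrite ln_powR mulNr mulrN => /ltW.
    exact.
  apply: (le_trans (ge0_ler_powR (ltW p0) _ _ le1)).
  - by rewrite nnegrE expvar_ge0.
  - by rewrite nnegrE mulr_ge0 ?powR_ge0// invr_ge0 ltW.
  rewrite powRM ?powR_ge0//; last by rewrite invr_ge0 ltW.
  rewrite -powRrM.
  rewrite (_ : - q * p = 2^-1 - 1)// /q; field; exact: lt0r_neq0.
rewrite (nnintZ (measurable_itv _) (mpow _) (fun _ _ => powR_ge0 _ _)
  (powR_ge0 _ _)).
by rewrite integral_powR_left ?invr_gt0// -EFinM ltry.
Qed.

Lemma expmom_gt0 (p : R) : 0 < p -> (0 < expmom p)%E.
Proof.
move=> p0; rewrite expmom_expvar//.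
apply: (@lt_le_trans _ _ (\int[mu]_(x in `]0%R, expR (- 1)[) (cst 1 x)%:E)%E).
  rewrite (nnint_cst_oo 1 (expR_ge0 _)) lte_fin mul1r subr0; exact: expR_gt0.
have e1 : expR (- 1) < 1 :> R by rewrite expR_lt1; lra.
have mp : measurable_fun setT (fun x : R => expvar 0 x `^ p).
  by apply: (measurableT_comp (@measurable_powR R p)); exact: measurable_expvar.
apply: (@le_trans _ _ (\int[mu]_(x in `]0%R, expR (- 1)[) (expvar 0 x `^ p)%:E)%E).
  apply: le_nnint => // x /=; rewrite in_itv/= => /andP[x0 xe].
  rewrite ler01/= [leLHS](_ : _ = 1 `^ p); last by rewrite powR1.
  have le1 : 1 <= expvar 0 x.
    rewrite /expvar le_max subr0; apply/orP; left.
    by move: xe; rewrite -ltr_ln ?posrE ?expR_gt0// expRK; lra.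
  by apply: (ge0_ler_powR (ltW p0)); rewrite ?nnegrE ?ler01 ?expvar_ge0.
apply: ge0_subset_integral => //.
- by apply/measurable_EFinP; exact: measurable_funTS.
- by move=> x _; rewrite lee_fin powR_ge0.
- by move=> x /=; rewrite !in_itv/= => /andP[-> /lt_trans->].
Qed.

Lemma expmomE (p : R) : 0 < p -> expmom p = (p * Gamma p)%:E.
Proof.
move=> p0.
have H : (expmom p = p%:E * \int[mu]_(x in `]0%R, +oo[) (x `^ (p - 1) * expR
  (- x))%:E)%E.
  rewrite /expmom; under eq_integral do rewrite -mulrA.
  rewrite nnintZ//; last exact: ltW.
  - exact: measurable_funM.
  - by move=> x _; rewrite mulr_ge0 ?powR_ge0 ?expR_ge0.
have fin : (\int[mu]_(x in `]0%R, +oo[) (x `^ (p - 1) * expR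
  (- x))%:E)%E \is a fin_num.
  rewrite ge0_fin_numE; last first.
    by apply: integral_ge0 => x _; rewrite lee_fin mulr_ge0 ?powR_ge0 ?expR_ge0.
  have := expmom_lty p0; rewrite H.
  by move: (\int[mu]_(x in _) _)%E => [r| |]//; rewrite ?ltry// gt0_muley ?lte_fin.
by rewrite H /Gamma /Rintegral EFinM fineK.
Qed.

Lemma expmom1 : expmom 1 = 1%E.
Proof.
rewrite -(@integral_exponential_pdf R 1)// /expmom.
transitivity (\int[mu]_(x in `[0%R, +oo[) (1 * expR (- 1 * x))%:E)%E.
  rewrite -integral_itv_obnd_cbnd; last first.
    apply/measurable_EFinP; apply: measurable_funTS; apply: measurable_funM => //.
    by apply: measurableT_comp; [exact: measurable_expR|exact: measurable_funM].
  apply: eq_integral => t _; rewrite subrr powRr0 mul1r; congr (_ * expR _)%:E;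
    ring.
by rewrite integral_mkcond; apply: eq_integral => t _; rewrite restrict_EFin.
Qed.

(** The square of u is the integral over t > 0 of 2 (u - t)_+, and the excess
    over t of an exponential variable has mean e^-t. *)
Lemma expmom2 : expmom 2 = 2%:E.
Proof.
have m : measurable_fun setT (fun q : R * R => 2 * Num.max (q.2 - q.1) 0).
  apply: measurable_funM => //; apply: measurable_maxr => //;
    apply: measurable_funB.
    exact: measurable_snd.
  exact: measurable_fst.
have H : (1%:E * \int[mu]_(x in `]0%R, 1%R[) (expvar 0 x `^ 2)%:E =
    \int[mu]_(t in `]0%R, +oo[) \int[mu]_(x in `]0%R, 1%R[) (2 * Num.max
      (expvar 0 x - t) 0)%:E)%E.
  apply: (tonelli_kernel (N := fun q => 2 * Num.max (q.2 - q.1) 0)) => //.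
  - exact: measurable_expvar.
  - by move=> x _; exact: expvar_ge0.
  - by move=> t u _ _; rewrite mulr_ge0// le_max lexx orbT.
  - by move=> u u0; exact: integral_ker1.
rewrite expmom_expvar// -[LHS]mul1e H.
transitivity (\int[mu]_(t in `]0%R, +oo[) (2 * expR (- t))%:E)%E.
  apply: eq_integral => t; rewrite inE/= in_itv/= andbT => t0.
  have me : measurable_fun setT (expvar t) := measurable_expvar t.
  transitivity (\int[mu]_(x in `]0%R, 1%R[) (2 * expvar t x `^ 1)%:E)%E.
    apply: eq_integral => x; rewrite inE/= in_itv/= => /andP[x0 x1].
    rewrite powRr1 ?expvar_ge0//= /expvar subr0.
    by rewrite (@max_l _ _ (- ln x))// oppr_ge0; apply: ln_le0; exact: ltW.
  rewrite nnintZ//; last 2 first.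
  - by apply: (measurableT_comp (@measurable_powR R 1)).
  - by move=> x _; rewrite powR_ge0.
  rewrite expvar_moment ?ltW// expmom1 mule1 -EFinM//.
rewrite (nnintZ (measurable_itv _) mexpN (fun t _ => expR_ge0 _) (ler0n _ 2)).
have -> : (\int[mu]_(t in `]0%R, +oo[) (expR (- t))%:E)%E = expmom 1.
  by apply: eq_integral => t _; rewrite subrr powRr0 !mul1r.
by rewrite expmom1 mule1.
Qed.

End exponential_moments.

(** * Comparison of moments *)

Section moment_comparison.
Context {R : realType}.
Notation mu := (@lebesgue_measure R).

(** The integral of a nonnegative function is a supremum over the simple
    functions below it, so that it is monotone without any measurability; this
    spares the measurability in t of the second moment of the excess over t. *)
Lemma ge0_le_integral_nonmeasurable (D : set R) (f g : R -> \bar R) :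
  (forall x, D x -> (0 <= f x)%E) -> (forall x, D x -> (f x <= g x)%E) ->
  (\int[mu]_(x in D) f x <= \int[mu]_(x in D) g x)%E.
Proof.
move=> f0 fg; rewrite !ge0_integralE//; last first.
  by move=> x Dx; exact: le_trans (f0 x Dx) (fg x Dx).
apply: le_ereal_sup => _ [h /= hf <-]; exists h => //= x.
apply: le_trans (hf x) _; rewrite !patchE; case: ifPn => // xD.
by apply: fg; rewrite -inE.
Qed.

Lemma measurable_excess (X : R -> R) t : measurable_fun setT X ->
  measurable_fun setT (excess X t).
Proof. by move=> mX; apply: measurable_maxr => //; exact: measurable_funB. Qed.

Lemma excess_ge0 (X : R -> R) t x : 0 <= excess X t x.
Proof. by rewrite le_max lexx orbT. Qed.

Lemma excess_le (X : R -> R) t x : 0 <= t -> 0 <= X x -> excess X t x <= X x.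
Proof. by move=> t0 X0; rewrite ge_max X0 andbT; lra. Qed.

Lemma excess_expvar t x : 0 <= t -> excess (@expvar R 0) t x = expvar t x.
Proof.
move=> t0; rewrite /excess /expvar subr0.
case: (leP (- ln x) 0) => l0; case: (leP (- ln x - t) 0) => lt;
  by [|rewrite max_r; lra|lra].
Qed.

Section kernel_moments.
Variables (A : set R) (X : R -> R) (p : R).
Hypotheses (mA : measurable A) (mX : measurable_fun setT X) (X0 : forall x, 0 <=
  X x).

Let mpow q : measurable_fun setT (fun t : R => t `^ q).
Proof. exact: measurable_powR. Qed.

Let mmax : measurable_fun setT (fun q : R * R => (Num.max (q.2 - q.1) 0)^+2).
Proof.
apply: measurable_funX; apply: measurable_maxr => //; apply: measurable_funB.
  exact: measurable_snd.
exact: measurable_fst.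
Qed.

Let mpow1 q : measurable_fun setT (fun z : R * R => z.1 `^ q).
Proof. by apply: (measurableT_comp (@measurable_powR R q));
  exact: measurable_fst. Qed.

Lemma kerA_moment : 2 < p ->
  ((kerA p)%:E * \int[mu]_(x in A) (X x `^ p)%:E =
   \int[mu]_(t in `]0%R, +oo[) ((t `^ (p - 3))%:E * \int[mu]_(x in A)
     ((excess X t x)^+2)%:E))%E.
Proof.
move=> p2.
rewrite (tonelli_kernel (N := fun q => q.1 `^ (p - 3) * (Num.max (q.2 - q.1)
  0)^+2) mA mX).
- apply: eq_integral => t _.
  rewrite -(nnintZ mA (f := fun x => (excess X t x)^+2)) ?powR_ge0//.
    by apply: measurable_funX; exact: measurable_excess.
  by move=> x _; rewrite sqr_ge0.
- by move=> x _; exact: X0.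
- exact: measurable_funM.
- by move=> t u _ _; apply: mulr_ge0; [exact: powR_ge0|exact: sqr_ge0].
- by apply: ltW; exact: kerA_gt0.
- by move=> u u0; exact: integral_kerA.
Qed.

Lemma kerB_moment : 1 < p -> p < 2 ->
  ((kerB p)%:E * \int[mu]_(x in A) (X x `^ p)%:E =
   \int[mu]_(t in `]0%R, +oo[) ((t `^ (p - 3))%:E *
     \int[mu]_(x in A) ((X x)^+2 - (excess X t x)^+2)%:E))%E.
Proof.
move=> p1 p2.
rewrite (tonelli_kernel (N := fun q => q.1 `^ (p - 3) * (q.2^+2 - (Num.max
  (q.2 - q.1) 0)^+2)) mA mX).
- apply: eq_integral => t; rewrite inE/= in_itv/= andbT => t0.
  rewrite -(nnintZ mA (f := fun x => (X x)^+2 - (excess X t x)^+2)) ?powR_ge0//.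
    by apply: measurable_funB; apply: measurable_funX => //;
      exact: measurable_excess.
  move=> x _; rewrite subr_ge0; apply: lerXn2r; rewrite ?nnegrE ?excess_ge0//.
  by apply: excess_le => //; exact: ltW.
- by move=> x _; exact: X0.
- apply: measurable_funM => //; apply: measurable_funB => //;
  apply: measurable_funX.
  exact: measurable_snd.
- move=> t u t0 u0 /=; apply: mulr_ge0; first exact: powR_ge0.
  rewrite subr_ge0; apply: lerXn2r; rewrite ?nnegrE ?le_max ?lexx ?orbT//.
  by rewrite ge_max u0 andbT; lra.
- by apply: ltW; exact: kerB_gt0.
- by move=> u u0; exact: integral_kerB.
Qed.

Lemma nnint_sqr_split t : 0 <= t ->
  (\int[mu]_(x in A) ((X x)^+2 - (excess X t x)^+2)%:E +
   \int[mu]_(x in A) ((excess X t x)^+2)%:E = \int[mu]_(x in A) ((X x)^+2)%:E)%E.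
Proof.
move=> t0.
have m1 : measurable_fun setT (fun x => (X x)^+2) by exact: measurable_funX.
have m2 : measurable_fun setT (fun x => (excess X t x)^+2).
  by apply: measurable_funX; exact: measurable_excess.
have m3 : measurable_fun setT (fun x => (X x)^+2 - (excess X t x)^+2)
  by exact: measurable_funB.
rewrite -(nnintD mA m3 m2).
- by apply: eq_integral => x _; rewrite subrK.
- move=> x _; rewrite subr_ge0; apply: lerXn2r; rewrite ?nnegrE ?excess_ge0//.
  exact: excess_le.
- by move=> x _; rewrite sqr_ge0.
Qed.

End kernel_moments.

Let expvar_sqr s : 0 <= s ->
  (\int[mu]_(x in `]0%R, 1%R[) ((expvar s x)^+2)%:E = (2 * expR (- s))%:E)%E.
Proof.
move=> s0; rewrite mulrC EFinM -expmom2 -expvar_moment//.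
by apply: eq_integral => x _; rewrite (@powR_mulrn _ _ 2)// expvar_ge0.
Qed.

Let mexpN : measurable_fun setT (fun t : R => expR (- t)).
Proof. by apply: measurableT_comp => //; exact: measurable_expR. Qed.

Let mW p : measurable_fun setT (fun t : R => t `^ (p - 3) * expR (- t)).
Proof. by apply: measurable_funM => //; exact: measurable_powR. Qed.

Let mW' p : measurable_fun setT (fun t : R => t `^ (p - 3) * (1 - expR (- t))).
Proof.
apply: measurable_funM; first exact: measurable_powR.
exact: measurable_funB.
Qed.

Variables (A : set R) (X : R -> R) (p : R).
Hypotheses (mA : measurable A) (mX : measurable_fun setT X) (X0 : forall x, 0 <=
  X x).
Hypothesis X2fin : (\int[mu]_(x in A) ((X x)^+2)%:E \is a fin_num)%E.
Hypothesis decay : forall t, 0 <= t ->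
  (\int[mu]_(x in A) ((excess X t x)^+2)%:E <=
   (expR (- t))%:E * \int[mu]_(x in A) ((X x)^+2)%:E)%E.

(** Integrate the bound on G(t) against t^(p-3).  The integral W of
    t^(p-3) e^-t that appears is the one obtained, with equality, for the
    exponential variable, which expresses it in terms of p Gamma(p). *)
Lemma moment_le_sqr : 2 <= p ->
  (2%:E * \int[mu]_(x in A) (X x `^ p)%:E <=
   (p * Gamma p)%:E * \int[mu]_(x in A) ((X x)^+2)%:E)%E.
Proof.
rewrite le_eqVlt => /predU1P[<-|p2].
  rewrite -expmomE// expmom2; apply: lee_wpmul2l; first by rewrite lee_fin.
  by apply: le_nnint => // [||x _]; [exact: (measurableT_comp
    (@measurable_powR R 2))|
    exact: measurable_funX|rewrite powR_ge0 (@powR_mulrn _ _ 2)//=].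
have p0 : 0 < p by lra.
have k0 := kerA_gt0 p2.
pose W := (\int[mu]_(t in `]0%R, +oo[) (t `^ (p - 3) * expR (- t))%:E)%E.
have EW : ((kerA p)%:E * (p * Gamma p)%:E = 2%:E * W)%E.
  rewrite -expmomE// expmom_expvar// kerA_moment//.
  - rewrite /W -(nnintZ (measurable_itv _) (mW p) _ (ler0n _ 2)); last first.
      by move=> t _; apply: mulr_ge0; [exact: powR_ge0|exact: expR_ge0].
    apply: eq_integral => t; rewrite inE/= in_itv/= andbT => t0.
    under eq_integral do rewrite (excess_expvar _ (ltW t0)).
    by rewrite (expvar_sqr (ltW t0)) -EFinM; congr (_%:E); ring.
  - exact: measurable_expvar.
  - by move=> x; exact: expvar_ge0.
have EX : ((kerA p)%:E * \int[mu]_(x in A) (X x `^ p)%:E <=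
    (fine (\int[mu]_(x in A) ((X x)^+2)%:E))%:E * W)%E.
  rewrite (kerA_moment mA mX X0 p2).
  have f0 : 0 <= fine (\int[mu]_(x in A) ((X x)^+2)%:E).
    by apply: fine_ge0; apply: nnint_ge0 => x; rewrite sqr_ge0.
  rewrite /W -(nnintZ (measurable_itv _) (mW p) _ f0); last first.
    by move=> t _; apply: mulr_ge0; [exact: powR_ge0|exact: expR_ge0].
  apply: ge0_le_integral_nonmeasurable => t; rewrite /= in_itv/= andbT => t0.
    by apply: mule_ge0; [rewrite lee_fin powR_ge0|apply: nnint_ge0 => x;
      rewrite sqr_ge0].
  rewrite (_ : (_ * (_ * _))%:E =
      (t `^ (p - 3))%:E * ((expR (- t))%:E * \int[mu]_(x in A) ((X x)^+2)%:E))%E.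
    by apply: lee_wpmul2l; [rewrite lee_fin powR_ge0|apply: decay; exact: ltW].
  by rewrite -[in RHS](fineK X2fin) -!EFinM; congr (_%:E); ring.
move: EX; rewrite -{2}(fineK X2fin).
move: W EW => [W| |].
- rewrite -!EFinM => -[EW].
  move: (\int[mu]_(x in A) (X x `^ p)%:E)%E => [m| |]//.
  + rewrite -!EFinM !lee_fin => H.
    rewrite -(ler_pM2l k0) [leRHS]mulrA EW; lra.
  + by rewrite gt0_muley ?lte_fin.
  + by rewrite gt0_muleNy ?lte_fin// => _; rewrite gt0_muleNy ?lte_fin// leNye.
- by rewrite gt0_muley ?lte_fin.
- by rewrite gt0_muleNy ?lte_fin.
Qed.

(** As for p >= 2, with u^2 - (u - t)_+^2 instead of (u - t)_+^2, which reverses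
    the inequality.  At p = 1 the kernel is no longer integrable, but the
    statement is the comparison of the excesses at t = 0. *)
Lemma sqr_le_moment : 1 <= p -> p <= 2 ->
  (\int[mu]_(x in A) ((X x)^+2)%:E <= 2%:E * \int[mu]_(x in A) (X x)%:E)%E ->
  ((p * Gamma p)%:E * \int[mu]_(x in A) ((X x)^+2)%:E <=
   2%:E * \int[mu]_(x in A) (X x `^ p)%:E)%E.
Proof.
rewrite le_eqVlt => /predU1P[<- _|p1].
  rewrite -expmomE// expmom1 mul1e => H.
  have -> : (\int[mu]_(x in A) (X x `^ 1)%:E = \int[mu]_(x in A) (X x)%:E)%E.
    by apply: eq_integral => x _; rewrite powRr1.
  exact: H.
rewrite le_eqVlt => /predU1P[->|p2] _.
  rewrite -expmomE// expmom2.
  have -> : (\int[mu]_(x in A) (X x `^ 2)%:E = \int[mu]_(x in A) ((X x)^+2)%:E)%E.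
    by apply: eq_integral => x _; rewrite (@powR_mulrn _ _ 2).
  exact: lexx.
have p0 : 0 < p by lra.
have k0 := kerB_gt0 p1 p2.
have w0 t : 0 <= t -> 0 <= t `^ (p - 3) * (1 - expR (- t)).
  move=> t0; apply: mulr_ge0; first exact: powR_ge0.
  by rewrite subr_ge0 expR_le1 oppr_le0.
have w0' t : `]0%R, +oo[%classic t -> 0 <= t `^ (p - 3) * (1 - expR (- t)).
  by rewrite /= in_itv/= andbT => t0; apply: w0; exact: ltW.
pose W := (\int[mu]_(t in `]0%R, +oo[) (t `^ (p - 3) * (1 - expR (- t)))%:E)%E.
have EW : ((kerB p)%:E * (p * Gamma p)%:E = 2%:E * W)%E.
  rewrite -expmomE// expmom_expvar// kerB_moment//; first last.
  - by move=> x; exact: expvar_ge0.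
  - exact: measurable_expvar.
  rewrite /W -(nnintZ (measurable_itv _) (mW' p) w0' (ler0n _ 2)).
  apply: eq_integral => t; rewrite inE/= in_itv/= andbT => t0.
  have := nnint_sqr_split (measurable_itv `]0, 1[) (measurable_expvar 0)
    (expvar_ge0 0) (ltW t0).
  rewrite (expvar_sqr (lexx 0)) oppr0 expR0.
  under [X in (_ + X)%E]eq_integral do rewrite (excess_expvar _ (ltW t0)).
  rewrite (expvar_sqr (ltW t0)).
  move: (\int[mu]_(x in _) _)%E => [v| |]//; rewrite -!EFinM -EFinD => -[E].
  by congr (_%:E); rewrite (_ : v = 2 - 2 * expR (- t)); [ring|lra].
pose S := fine (\int[mu]_(x in A) ((X x)^+2)%:E).
have f0 : 0 <= S by apply: fine_ge0; apply: nnint_ge0 => x; rewrite sqr_ge0.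
have ES : (\int[mu]_(x in A) ((X x)^+2)%:E = S%:E)%E by rewrite fineK.
have EX : (S%:E * W <= (kerB p)%:E * \int[mu]_(x in A) (X x `^ p)%:E)%E.
  rewrite (kerB_moment mA mX X0 p1 p2) /W -(nnintZ (measurable_itv _) (mW' p)
    w0' f0).
  apply: ge0_le_integral_nonmeasurable => t; rewrite /= in_itv/= andbT => t0.
    by rewrite lee_fin mulr_ge0// w0 ?ltW.
  rewrite mulrCA EFinM; apply: lee_wpmul2l; first by rewrite lee_fin powR_ge0.
  have := decay (ltW t0); have := nnint_sqr_split mA mX X0 (ltW t0).
  have := @nnint_ge0 _ (fun x => (excess X t x)^+2) A (fun x => sqr_ge0 _).
  rewrite ES.
  move: (\int[mu]_(x in A) ((X x)^+2 - _)%:E)%E => u.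
  move: (\int[mu]_(x in A) ((excess X t x)^+2)%:E)%E => [v| |]//.
  case: u => [u| |]//; rewrite -?EFinM -?EFinD ?lee_fin => v0 [E]; lra.
rewrite ES; move: EX.
move: W EW => [W| |].
- rewrite -!EFinM => -[EW].
  move: (\int[mu]_(x in A) (X x `^ p)%:E)%E => [m| |]//.
  + rewrite -!EFinM !lee_fin => H.
    rewrite -(ler_pM2l k0) [leLHS]mulrA EW; lra.
  + by rewrite [(2%:E * _)%E]gt0_muley ?lte_fin// leey.
  + by rewrite gt0_muleNy ?lte_fin.
- by rewrite gt0_muley ?lte_fin.
- by rewrite gt0_muleNy ?lte_fin.
Qed.

End moment_comparison.

(** * Comparison of central moments at an arbitrary scale *)

Section scaled_comparison.
Context {R : realType}.
Notation mu := (@lebesgue_measure R).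
Variables (phi : R -> R) (a b m N : R).
Hypotheses (ab : a < b) (N0 : 0 < N) (mphi : measurable_fun setT phi).
Hypothesis osc : forall c d, a <= c -> c < d -> d <= b -> exists k : R,
  (\int[mu]_(x in `]c, d[) ((phi x - k)^+2)%:E <= (N^+2 * (d - c))%:E)%E.
Hypothesis oscm :
  (\int[mu]_(x in `]a, b[) ((phi x - m)^+2)%:E <= (N^+2 * (b - a))%:E)%E.

Let psi x := N^-1 * phi x.
Let X x := `|psi x - N^-1 * m|.

Let mpsi : measurable_fun setT psi.
Proof. exact: measurable_funM. Qed.

Let mX : measurable_fun setT X.
Proof. by apply: measurableT_comp => //; exact: measurable_funB. Qed.

Let X0 x : 0 <= X x. Proof. exact: normr_ge0. Qed.

Let XE x : X x = N^-1 * `|phi x - m|.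
Proof. by rewrite /X /psi -mulrBr normrM gtr0_norm// invr_gt0. Qed.

Let N2 : 0 <= N^-1 ^+ 2. Proof. exact: sqr_ge0. Qed.

Let osc_scale c d k : (\int[mu]_(x in `]c, d[) ((phi x - k)^+2)%:E <= (N^+2 *
  (d - c))%:E)%E ->
  (\int[mu]_(x in `]c, d[) ((psi x - N^-1 * k)^+2)%:E <= (d - c)%:E)%E.
Proof.
move=> H.
have mk : measurable_fun setT (fun x => (phi x - k)^+2).
  by apply: measurable_funX; exact: measurable_funB.
have -> : (\int[mu]_(x in `]c, d[) ((psi x - N^-1 * k)^+2)%:E =
    (N^-1^+2)%:E * \int[mu]_(x in `]c, d[) ((phi x - k)^+2)%:E)%E.
  rewrite -(nnintZ (measurable_itv _) mk (fun x _ => sqr_ge0 _) N2).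
  by apply: eq_integral => x _; rewrite /psi -mulrBr exprMn.
apply: (le_trans (lee_wpmul2l _ H)); first by rewrite lee_fin.
by rewrite -EFinM lee_fin mulrA -exprMn mulVf ?gt_eqF// expr1n mul1r.
Qed.

Let osc1 c d : a <= c -> c < d -> d <= b -> exists k : R,
  (\int[mu]_(x in `]c, d[) ((psi x - k)^+2)%:E <= (d - c)%:E)%E.
Proof. by move=> ac cd db; have [k /osc_scale Hk] := osc ac cd db;
  exists (N^-1 * k). Qed.

Let oscm1 : (\int[mu]_(x in `]a, b[) ((psi x - N^-1 * m)^+2)%:E <= (b - a)%:E)%E.
Proof. exact: osc_scale. Qed.

Let X2E : (\int[mu]_(x in `]a, b[) ((X x)^+2)%:E =
  \int[mu]_(x in `]a, b[) ((psi x - N^-1 * m)^+2)%:E)%E.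
Proof. by apply: eq_integral => x _; rewrite /X real_normK ?num_real. Qed.

Let X2fin : (\int[mu]_(x in `]a, b[) ((X x)^+2)%:E)%E \is a fin_num.
Proof.
rewrite ge0_fin_numE; last by apply: nnint_ge0 => x; exact: sqr_ge0.
by rewrite X2E; apply: le_lt_trans oscm1 _; exact: ltry.
Qed.

Let decay t : 0 <= t ->
  (\int[mu]_(x in `]a, b[) ((excess X t x)^+2)%:E <=
   (expR (- t))%:E * \int[mu]_(x in `]a, b[) ((X x)^+2)%:E)%E.
Proof. exact: excess_sqr_decay. Qed.

Let X2X1 : (\int[mu]_(x in `]a, b[) ((X x)^+2)%:E <=
            2%:E * \int[mu]_(x in `]a, b[) (X x)%:E)%E.
Proof.
have := excess_sqr_le ab mpsi osc1 oscm1 (lexx 0).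
have E x : excess X 0 x = X x by rewrite /excess subr0 max_l.
by under eq_integral do rewrite E; under [X in (_ <=
  _ * X)%E]eq_integral do rewrite E.
Qed.

Let Y x := `|phi x - m|.

Let mY : measurable_fun setT Y.
Proof. by apply: measurableT_comp => //; exact: measurable_funB. Qed.

Let Xpow p : (\int[mu]_(x in `]a, b[) (X x `^ p)%:E =
  (N `^ (- p))%:E * \int[mu]_(x in `]a, b[) (`|phi x - m| `^ p)%:E)%E.
Proof.
have mYp : measurable_fun setT (fun x => Y x `^ p).
  by apply: (measurableT_comp (@measurable_powR R p)).
rewrite -(nnintZ (measurable_itv _) mYp (fun _ _ => powR_ge0 _ _) (powR_ge0 _ _)).
apply: eq_integral => x _; rewrite XE powRM ?normr_ge0 ?invr_ge0 ?(ltW N0)//.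
by rewrite -powR_inv1 ?(ltW N0)// -powRrM mulN1r.
Qed.

Let Xsqr : (\int[mu]_(x in `]a, b[) ((X x)^+2)%:E =
  (N `^ (- 2))%:E * \int[mu]_(x in `]a, b[) ((phi x - m)^+2)%:E)%E.
Proof.
have -> : (\int[mu]_(x in `]a, b[) ((phi x - m)^+2)%:E =
    \int[mu]_(x in `]a, b[) (`|phi x - m| `^ 2)%:E)%E.
  by apply: eq_integral => x _; rewrite (@powR_mulrn _ _ 2)// real_normK ?num_real.
rewrite -Xpow.
by apply: eq_integral => x _; rewrite (@powR_mulrn _ _ 2).
Qed.

(** Scaling by N reduces to the comparison of moments for norm 1. *)
Lemma central_moment_le_variance p : 2 <= p ->
  (2%:E * \int[mu]_(x in `]a, b[) (`|phi x - m| `^ p)%:E <=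
   (p * Gamma p * N `^ (p - 2))%:E * \int[mu]_(x in `]a, b[) ((phi x - m)^+2)%:E)%E.
Proof.
move=> p2.
have := moment_le_sqr (measurable_itv _) mX X0 X2fin decay p2.
rewrite Xpow Xsqr !muleA -!EFinM => H.
have Np : 0 < N `^ p by exact: powR_gt0.
have := lee_wpmul2l (ltW Np : (0 <= (N `^ p)%:E)%E) H.
rewrite !muleA -!EFinM.
have -> : N `^ p * (2 * N `^ (- p)) = 2.
  by rewrite mulrCA powRN divff ?mulr1// gt_eqF.
have -> // : N `^ p * (p * Gamma p * N `^ (- 2)) = p * Gamma p * N `^ (p - 2).
by rewrite mulrCA -powRD ?(gt_eqF N0) ?implybT.
Qed.

Lemma variance_le_central_moment p : 1 <= p -> p <= 2 ->
  ((p * Gamma p)%:E * \int[mu]_(x in `]a, b[) ((phi x - m)^+2)%:E <=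
   (2 * N `^ (2 - p))%:E * \int[mu]_(x in `]a, b[) (`|phi x - m| `^ p)%:E)%E.
Proof.
move=> p1 p2.
have := sqr_le_moment (measurable_itv _) mX X0 X2fin decay p1 p2 X2X1.
rewrite Xpow Xsqr !muleA -!EFinM => H.
have Np : 0 < N `^ 2 by exact: powR_gt0.
have := lee_wpmul2l (ltW Np : (0 <= (N `^ 2)%:E)%E) H.
rewrite !muleA -!EFinM.
have -> : N `^ 2 * (2 * N `^ (- p)) = 2 * N `^ (2 - p).
  by rewrite mulrCA -powRD ?(gt_eqF N0) ?implybT.
have -> // : N `^ 2 * (p * Gamma p * N `^ (- 2)) = p * Gamma p.
by rewrite mulrCA powRN divff ?mulr1// gt_eqF.
Qed.

End scaled_comparison.

(** * Averages and oscillations over intervals *)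

Section averages.
Context {R : realType}.
Notation mu := (@lebesgue_measure R).

Lemma bounded_intervalE (Q : set R) : bounded_interval Q ->
  exists a b b0 b1, a < b /\ Q = [set` Interval (BSide b0 a) (BSide b1 b)].
Proof.
move=> [/is_intervalP iQ [M [_ HM]] mQ].
have {}HM x : Q x -> `|x| <= `|M| + 1 by apply: HM; rewrite ltr_pwDr// ler_norm.
have hl : has_lbound Q.
  by exists (- (`|M| + 1)) => x /HM; rewrite ler_norml => /andP[].
have hu : has_ubound Q.
  by exists (`|M| + 1) => x /HM; rewrite ler_norml => /andP[].
move: iQ; rewrite /Rhull (asboolT hl) (asboolT hu) => iQ.
exists (inf Q), (sup Q), `[< Q (inf Q) >], (~~ `[< Q (sup Q) >]); split => //.
move: mQ; rewrite {1}iQ lebesgue_measure_itv/= lte_fin.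
by case: ifPn => //; rewrite ltxx.
Qed.

Section on_interval.
Variables (a b : R) (b0 b1 : bool).
Hypothesis ab : a < b.
Let Q : set R := [set` Interval (BSide b0 a) (BSide b1 b)].

Lemma avg_itv (f : R -> R) : measurable_fun `]a, b[ f ->
  avg Q f = ((b - a)^-1%:E * \int[mu]_(x in `]a, b[) (f x)%:E)%E.
Proof.
move=> mf; rewrite /avg /Q integral_itv_bndoo; last exact/measurable_EFinP.
rewrite lebesgue_measure_itv/= lte_fin ab -EFinB inver subr_eq0. by rewrite
  (gt_eqF ab).
Qed.

Lemma bounded_interval_itv : bounded_interval Q.
Proof.
split; first exact: interval_is_interval.
- exists (`|a| + `|b|); split; first exact: num_real.
  move=> M HM x; rewrite /Q /= in_itv/= => /andP[].
  move=> /lteifW ax /lteifW xb; rewrite ler_norml.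
  have := ler_norm a; have := ler_norm b; have := ler_norm (- a); have :=
    ler_norm (- b).
  rewrite !normrN; move: (normr_ge0 a) (normr_ge0 b) => *.
  by apply/andP; split; lra.
- by rewrite lebesgue_measure_itv/= lte_fin ab -EFinB lte_fin subr_gt0.
Qed.

Section integrable_function.
Variable phi : R -> R.
Hypothesis intphi : mu.-integrable `]a, b[ (EFin \o phi).

Let mphi : measurable_fun `]a, b[ phi.
Proof. by apply/measurable_EFinP; case/integrableP: intphi. Qed.

Lemma avg_fine : avg Q phi = ((b - a)^-1 * \int[mu]_(x in `]a, b[) phi x)%:E.
Proof. by rewrite avg_itv// EFinM /Rintegral fineK// integrable_fin_num. Qed.

Hypothesis intphi2 : mu.-integrable `]a, b[ (EFin \o (fun x => phi x ^+ 2)).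

Lemma avg_sqr_fine :
  avg Q (fun x => phi x ^+ 2) = ((b - a)^-1 * \int[mu]_(x in `]a, b[)
    (phi x ^+ 2))%:E.
Proof.
rewrite avg_itv; last exact: measurable_funX.
by rewrite EFinM /Rintegral fineK// integrable_fin_num.
Qed.

Lemma integral_sqr_dist (k : R) :
  (\int[mu]_(x in `]a, b[) ((phi x - k)^+2)%:E =
   (\int[mu]_(x in `]a, b[) (phi x ^+ 2)
     - 2 * k * \int[mu]_(x in `]a, b[) phi x + k ^+ 2 * (b - a))%:E)%E.
Proof.
have i1 : mu.-integrable `]a, b[ (EFin \o (cst (k ^+2) : R -> R)).
  apply: measurable_bounded_integrable => //=; last exact: bounded_cst.
  by rewrite lebesgue_measure_itv/= lte_fin ab -EFinB ltry.
have i2 : mu.-integrable `]a, b[ (fun x => (2 * k)%:E * (phi x)%:E)%E.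
  exact: integrableZl.
have E x : ((phi x - k)^+2)%:E = ((phi x ^+ 2)%:E - (2 * k)%:E * (phi x)%:E +
  (k ^+ 2)%:E)%E.
  by rewrite -EFinM -EFinB -EFinD; congr (_%:E); ring.
under eq_integral do rewrite E.
rewrite integralD//; last exact: integrableB.
rewrite integralB// integralZl// nnint_cst_oo ?(ltW ab)//.
by rewrite !EFinD EFinN !EFinM /Rintegral !fineK// integrable_fin_num.
Qed.

(** The variance is the least value of the mean square distance to a
    constant k. *)
Lemma oscillation_le1 (k : R) :
  (\int[mu]_(x in `]a, b[) ((phi x - k)^+2)%:E <= (b - a)%:E)%E ->
  ((avg Q (fun x => phi x ^+ 2)%R - avg Q phi ^+ 2) `^ 2^-1 <= 1%:E)%E.
Proof.
rewrite integral_sqr_dist lee_fin avg_sqr_fine avg_fine -EFin_expe -EFinB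
  poweR_EFin lee_fin.
set S := \int[mu]_(x in _) (phi x ^+ 2); set T := \int[mu]_(x in _) phi x => H.
have L0 : 0 < b - a by rewrite subr_gt0.
set r := (X in X `^ _).
have r1 : r <= 1.
  have : 0 <= (k - (b - a)^-1 * T)^+2 by exact: sqr_ge0.
  have : (b - a)^-1 * (S - 2 * k * T + k ^+ 2 * (b - a)) <= 1.
    by rewrite ler_pdivrMl// mulr1.
  have -> : (b - a)^-1 * (S - 2 * k * T + k ^+ 2 * (b - a)) =
      (b - a)^-1 * S - 2 * k * ((b - a)^-1 * T) + k ^+ 2.
    by field; exact: lt0r_neq0.
  rewrite /r; lra.
(* a negative number raised to a power is 1 by convention *)
have [r0|r0] := ltP r 0; first by rewrite lt0_powR1.
rewrite [leRHS](_ : _ = 1 `^ 2^-1); last by rewrite powR1.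
by apply: ge0_ler_powR; rewrite ?nnegrE.
Qed.

End integrable_function.

(** A bound on the difference of averages forces the square of phi to be
    integrable, since the average of phi is finite; the difference is then the
    variance. *)
Lemma oscillation_bound (phi : R -> R) (N : R) : 0 <= N ->
  mu.-integrable `]a, b[ (EFin \o phi) ->
  ((avg Q (fun x => phi x ^+ 2)%R - avg Q phi ^+ 2) `^ 2^-1 <= N%:E)%E ->
  (\int[mu]_(x in `]a, b[) ((phi x - fine (avg Q phi))^+2)%:E <= (N ^+ 2 *
    (b - a))%:E)%E.
Proof.
move=> N0 intphi H.
have mphi : measurable_fun `]a, b[ phi by apply/measurable_EFinP;
  case/integrableP: intphi.
have L0 : 0 < b - a by rewrite subr_gt0.
have intphi2 : mu.-integrable `]a, b[ (EFin \o (fun x => phi x ^+ 2)).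
  apply/integrableP; split; first by apply/measurable_EFinP; exact: measurable_funX.
  under eq_integral do rewrite /= ger0_norm ?sqr_ge0//.
  rewrite ltNge leye_eq; apply/negP => /eqP E.
  move: H; rewrite avg_itv; last exact: measurable_funX.
  rewrite E gt0_muley ?lte_fin ?invr_gt0// avg_fine// -EFin_expe addye//
    poweRyr; last first.
    by rewrite gt_eqF// invr_gt0.
  by [].
move: H; rewrite avg_sqr_fine// avg_fine// -EFin_expe -EFinB poweR_EFin lee_fin
  /= integral_sqr_dist// lee_fin.
set S := \int[mu]_(x in _) (phi x ^+ 2); set T := \int[mu]_(x in _) phi x.
set r := (X in X `^ _) => H.
have rN : r <= N ^+ 2.
  have [r0|r0] := ltP r 0; first by rewrite (le_trans (ltW r0))// sqr_ge0.
  rewrite powR12_sqrt// in H.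
  by rewrite -(sqr_sqrtr r0); apply: lerXn2r; rewrite ?nnegrE ?sqrtr_ge0.
rewrite -ler_pdivrMr//; apply: le_trans rN; rewrite le_eqVlt; apply/orP; left;
  apply/eqP.
by rewrite /r; field; exact: lt0r_neq0.
Qed.

End on_interval.
End averages.

(** * Means of powers *)

Section inequalities.
Context {R : realType}.
Notation mu := (@lebesgue_measure R).

(** The tangent to y^r at A lies below the graph; this is Young's inequality
    for y and A^(r-1), and its terms are all nonnegative. *)
Lemma powR_tangent (r y A : R) : 1 <= r -> 0 <= y -> 0 <= A ->
  r * A `^ (r - 1) * y <= y `^ r + (r - 1) * A `^ r.
Proof.
rewrite le_eqVlt => /predU1P[<- y0 A0|r1 y0 A0].
  by rewrite subrr powRr0 powRr1// mul0r addr0 !mul1r.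
have r0 : 0 < r by lra.
have r10 : 0 < r - 1 by lra.
pose q := r / (r - 1).
have q0 : 0 < q by rewrite divr_gt0.
have rq : r^-1 + q^-1 = 1.
  by rewrite /q; field; rewrite !lt0r_neq0.
have := conjugate_powR y0 (powR_ge0 A (r - 1)) r0 q0 rq.
rewrite -powRrM (_ : (r - 1) * q = r); last by rewrite /q; field; rewrite lt0r_neq0.
move=> H; have := ler_wpM2l (ltW r0) H.
have -> : r * (y `^ r / r + A `^ r / q) = y `^ r + (r - 1) * A `^ r.
  by rewrite /q; field; rewrite !lt0r_neq0.
by rewrite (mulrC y) mulrA.
Qed.

(** Integrate the tangent inequality at the mean of Y. *)
Lemma power_mean (Y : R -> R) (a b r : R) : a < b -> 1 <= r ->
  measurable_fun setT Y -> (forall x, 0 <= Y x) ->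
  (\int[mu]_(x in `]a, b[) (Y x)%:E < +oo)%E ->
  (((b - a)^-1%:E * \int[mu]_(x in `]a, b[) (Y x)%:E) `^ r <=
   (b - a)^-1%:E * \int[mu]_(x in `]a, b[) (Y x `^ r)%:E)%E.
Proof.
move=> ab r1 mY Y0 Yfin.
have L0 : 0 < b - a by rewrite subr_gt0.
have Li0 : 0 <= (b - a)^-1 by rewrite invr_ge0 ltW.
pose I := fine (\int[mu]_(x in `]a, b[) (Y x)%:E).
have EI : (\int[mu]_(x in `]a, b[) (Y x)%:E = I%:E)%E.
  by rewrite fineK// ge0_fin_numE// nnint_ge0.
have I0 : 0 <= I by rewrite -lee_fin -EI nnint_ge0.
rewrite EI -EFinM poweR_EFin.
set A := (b - a)^-1 * I.
have A0 : 0 <= A by exact: mulr_ge0.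
have IA : I = A * (b - a) by rewrite /A mulrAC mulVf ?mul1r// gt_eqF.
have mYr : measurable_fun setT (fun x => Y x `^ r).
  by apply: (measurableT_comp (@measurable_powR R r)).
have c0 : 0 <= r * A `^ (r - 1) by rewrite mulr_ge0 ?powR_ge0//; lra.
have c1 : 0 <= (r - 1) * A `^ r by rewrite mulr_ge0 ?powR_ge0//; lra.
have H : (\int[mu]_(x in `]a, b[) ((r * A `^ (r - 1)) * Y x)%:E <=
          \int[mu]_(x in `]a, b[) (Y x `^ r + cst ((r - 1) * A `^ r) x)%:E)%E.
  apply: le_nnint => //.
  - exact: measurable_funM.
  - exact: measurable_funD.
  by move=> x _; rewrite mulr_ge0//= powR_tangent.
move: H; rewrite (nnintZ (measurable_itv _) mY (fun x _ => Y0 x) c0) EI.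
rewrite (nnintD (measurable_itv _) mYr (measurable_cst _) (fun x _ =>
  powR_ge0 _ _) (fun _ _ => c1)).
rewrite (nnint_cst_oo _ (ltW ab)).
move: (\int[mu]_(x in _) (Y x `^ r)%:E)%E (nnint_ge0 `]a, b[ (fun x => powR_ge0
  (Y x) r)) => [S| |]// S0.
  rewrite -!EFinM -EFinD !lee_fin IA => H.
  rewrite ler_pdivlMl//.
  have E : A `^ (r - 1) * A = A `^ r.
    by rewrite mulrC mulr_powRB1//; lra.
  have {H} : r * (A `^ (r - 1) * A) * (b - a) <= S + (r - 1) * A `^ r * (b - a).
    by move: H; rewrite !mulrA.
  rewrite E; lra.
by move=> _; rewrite gt0_muley ?leey// lte_fin invr_gt0.
Qed.

End inequalities.

(** * Both inequalities on BMO *)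

Section bmo_inequalities.
Context {R : realType}.
Notation mu := (@lebesgue_measure R).

Lemma mulr_Gamma_gt0 (p : R) : 0 < p -> 0 < p * Gamma p.
Proof. by move=> p0; rewrite -lte_fin -expmomE// expmom_gt0. Qed.

Lemma bmo_norm_ge0 (Q : set R) (phi : R -> R) : bounded_interval Q ->
  (0 <= bmo_norm Q phi)%E.
Proof.
move=> bQ; apply: (@le_trans _ _
  ((avg Q (fun x => phi x ^+ 2)%R - avg Q phi ^+ 2) `^ 2^-1)%E).
  exact: poweR_ge0.
by apply: ereal_sup_ubound; exists Q => //=; split.
Qed.

Section fixed_function.
Variables (a b : R) (b0 b1 : bool).
Hypothesis ab : a < b.
Let Q : set R := [set` Interval (BSide b0 a) (BSide b1 b)].
Variable phi : R -> R.
Hypothesis bmo : in_BMO Q phi.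

Let N := fine (bmo_norm Q phi).
Let m := fine (avg Q phi).
Let phi1 := phi \_ `]a, b[%classic.
Let Y x := `|phi1 x - m|.

Let bQ : bounded_interval Q. Proof. exact: bounded_interval_itv. Qed.

Let NE : bmo_norm Q phi = N%:E.
Proof. by rewrite /N fineK// ge0_fin_numE ?bmo_norm_ge0//; case: bmo. Qed.

Let N0 : 0 <= N. Proof. by rewrite -lee_fin -NE bmo_norm_ge0. Qed.

Let intphi : mu.-integrable `]a, b[ (EFin \o phi).
Proof.
case: bmo => [i _]; apply: integrableS i => //; first exact: measurable_itv.
exact: subset_itvW.
Qed.

Let mphi : measurable_fun `]a, b[ phi.
Proof. by apply/measurable_EFinP; case/integrableP: intphi. Qed.

Let mphi1 : measurable_fun setT phi1.
Proof. exact: (measurable_restrictT phi (measurable_itv _)).1 mphi. Qed.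

Let phi1E c d : a <= c -> d <= b -> {in `]c, d[%classic, phi1 =1 phi}.
Proof.
move=> ac db x; rewrite inE/= in_itv/= => /andP[cx xd].
by rewrite /phi1 patchE mem_set//= in_itv/= (le_lt_trans ac cx) (lt_le_trans xd db).
Qed.

Let sqr_phi1 c d k : a <= c -> d <= b ->
  (\int[mu]_(x in `]c, d[) ((phi1 x - k)^+2)%:E =
   \int[mu]_(x in `]c, d[) ((phi x - k)^+2)%:E)%E.
Proof. by move=> ac db; apply: eq_integral => x xcd; rewrite (phi1E ac db). Qed.

Let osc c d : a <= c -> c < d -> d <= b -> exists k : R,
  (\int[mu]_(x in `]c, d[) ((phi1 x - k)^+2)%:E <= (N^+2 * (d - c))%:E)%E.
Proof.
move=> ac cd db; exists (fine (avg `]c, d[ phi)).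
rewrite sqr_phi1//.
apply: (@oscillation_bound _ c d false true) => //.
  by apply: integrableS intphi => //; exact: subset_itvW.
rewrite -NE; apply: ereal_sup_ubound => /=; exists `]c, d[%classic => //; split.
  exact: bounded_interval_itv.
exact: subset_itvW.
Qed.

Let oscm : (\int[mu]_(x in `]a, b[) ((phi1 x - m)^+2)%:E <= (N^+2 * (b - a))%:E)%E.
Proof.
rewrite sqr_phi1//.
apply: oscillation_bound => //.
by rewrite -NE; apply: ereal_sup_ubound; exists Q => //=; split.
Qed.

Let mY : measurable_fun setT Y.
Proof. by apply: measurableT_comp => //; exact: measurable_funB. Qed.

Let mYp p : measurable_fun setT (fun x => Y x `^ p).
Proof. by apply: (measurableT_comp (@measurable_powR R p)). Qed.

Let S := fine (\int[mu]_(x in `]a, b[) ((phi1 x - m)^+2)%:E).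

Let SE : (\int[mu]_(x in `]a, b[) ((phi1 x - m)^+2)%:E = S%:E)%E.
Proof.
rewrite /S fineK// ge0_fin_numE; last by apply: nnint_ge0 => x; exact: sqr_ge0.
by apply: le_lt_trans oscm _; exact: ltry.
Qed.

Let S0 : 0 <= S.
Proof. by rewrite -lee_fin -SE; apply: nnint_ge0 => x; exact: sqr_ge0. Qed.

Lemma central_momentE p : central_moment Q phi p =
  ((b - a)^-1%:E * \int[mu]_(x in `]a, b[) (`|phi1 x - m| `^ p)%:E)%E.
Proof.
rewrite /central_moment -/m avg_itv//; last first.
  apply: (measurableT_comp (@measurable_powR R p)).
  by apply: measurableT_comp => //; exact: measurable_funB.
congr (_ * _)%E; apply: eq_integral => x xab.
by rewrite (phi1E (lexx a) (lexx b)).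
Qed.

Let moment_fin p : 1 <= p -> p <= 2 -> (\int[mu]_(x in `]a, b[)
  (Y x `^ p)%:E < +oo)%E.
Proof.
move=> p1 p2.
apply: (@le_lt_trans _ _ (\int[mu]_(x in `]a, b[)
  ((phi1 x - m)^+2 + cst 1 x)%:E)%E).
  apply: le_nnint => //.
    apply: measurable_funD => //; apply: measurable_funX; exact: measurable_funB.
  move=> x _; rewrite powR_ge0/= -[(phi1 x - m)^+2]real_normK ?num_real// -/(Y x).
  have Y0 : 0 <= Y x by exact: normr_ge0.
  have [y1|y1] := leP (Y x) 1.
    apply: (@le_trans _ _ 1); last by rewrite lerDr sqr_ge0.
    rewrite [leRHS](_ : _ = 1 `^ p); last by rewrite powR1.
    by apply: ge0_ler_powR; rewrite ?nnegrE//; lra.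
  apply: (@le_trans _ _ (Y x `^ 2)); first by apply: ler_powR => //; exact: ltW.
  by rewrite (@powR_mulrn _ _ 2)// lerDl.
have m1 : measurable_fun setT (fun x => (phi1 x - m)^+2).
  by apply: measurable_funX; exact: measurable_funB.
rewrite (nnintD (measurable_itv _) m1 (measurable_cst _) (fun x _ => sqr_ge0 _)
  (fun _ _ => ler01)).
by rewrite SE (nnint_cst_oo _ (ltW ab)) -EFinD ltry.
Qed.

Lemma central_moment_lower p1 p2 : 1 <= p1 -> p1 <= 2 -> 2 <= p2 ->
  (central_moment Q phi p1 `^ (p2 / p1) <= central_moment Q phi p2)%E.
Proof.
move=> h1 h2 h3; rewrite !central_momentE.
have p10 : 0 < p1 by lra.
have r1 : 1 <= p2 / p1 by rewrite ler_pdivlMr// mul1r; lra.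
have := power_mean ab r1 (mYp p1) (fun x => powR_ge0 _ _) (moment_fin h1 h2).
have -> // : (\int[mu]_(x in `]a, b[) ((Y x `^ p1) `^ (p2 / p1))%:E =
  \int[mu]_(x in `]a, b[) (Y x `^ p2)%:E)%E.
apply: eq_integral => x _; rewrite -powRrM; congr (_ `^ _)%:E.
by field; exact: lt0r_neq0.
Qed.

(** Chain the comparisons of the central moments of orders p2 and p1 with the
    variance.  When the norm vanishes, the comparison at scale 1 shows that the
    central moment of order p2 vanishes with the variance. *)
Lemma central_moment_upper p1 p2 : 1 <= p1 -> p1 <= 2 -> 2 <= p2 ->
  (central_moment Q phi p2 <=
   ((p2 * Gamma p2) / (p1 * Gamma p1))%:E
   * bmo_norm Q phi `^ (p2 - p1) * central_moment Q phi p1)%E.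
Proof.
move=> h1 h2 h3; rewrite !central_momentE NE poweR_EFin.
have p10 : 0 < p1 by lra.
have p20 : 0 < p2 by lra.
have e1 := mulr_Gamma_gt0 p10.
have e2 := mulr_Gamma_gt0 p20.
have L0 : 0 < b - a by rewrite subr_gt0.
have Li0 : 0 <= (b - a)^-1 by rewrite invr_ge0 ltW.
have I1E := fineK (_ : (\int[mu]_(x in `]a, b[) (Y x `^ p1)%:E)%E \is a fin_num).
rewrite ge0_fin_numE ?moment_fin// in I1E; last by apply: nnint_ge0 => x;
  exact: powR_ge0.
have {}I1E := I1E isT.
have I10 : 0 <= fine (\int[mu]_(x in `]a, b[) (Y x `^ p1)%:E).
  by apply: fine_ge0; apply: nnint_ge0 => x; exact: powR_ge0.
rewrite -/(Y _) -I1E.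
set I1 := fine _ in I10 *.
have [NN|NN] := ltP 0 N.
- have := central_moment_le_variance ab NN mphi1 osc oscm h3.
  have := variance_le_central_moment ab NN mphi1 osc oscm h1 h2.
  rewrite SE -/(Y _) -I1E -!EFinM lee_fin => H1.
  move: (\int[mu]_(x in _) (_ `^ p2)%:E)%E => [I2| |].
  + rewrite -!EFinM !lee_fin => H2.
    rewrite [leRHS]mulrCA; apply: ler_wpM2l => //.
    have -> : N `^ (p2 - p1) = N `^ (p2 - 2) * N `^ (2 - p1).
      rewrite -powRD; last by rewrite (gt_eqF NN) implybT.
      by congr (_ `^ _); ring.
    have u0 : 0 <= N `^ (p2 - 2) by exact: powR_ge0.
    move: (N `^ (p2 - 2)) (N `^ (2 - p1)) u0 H1 H2 => u v u0 H1 H2.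
    rewrite -(ler_pM2l e1).
    have -> : p1 * Gamma p1 * (p2 * Gamma p2 / (p1 * Gamma p1) * (u * v) * I1) =
        p2 * Gamma p2 * u * (v * I1).
      by move: e1 => /lt0r_neq0; move: (p1 * Gamma p1) => e e0; field.
    have := ler_wpM2l (ltW e1) H2.
    have := ler_wpM2l (mulr_ge0 (ltW e2) u0) H1.
    rewrite -/I1; move: (p1 * Gamma p1) (p2 * Gamma p2) => e f; lra.
  + by rewrite gt0_muley ?lte_fin.
  + by move=> _; rewrite gt0_muleNy ?leNye// lte_fin invr_gt0.
- have N00 : N = 0 by apply/eqP; rewrite eq_le NN N0.
  have S00 : S <= 0 by rewrite -lee_fin -SE; apply: (le_trans oscm);
    rewrite N00 expr0n mul0r.
  have oscm1 : (\int[mu]_(x in `]a, b[) ((phi1 x - m)^+2)%:E <= (1^+2 *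
    (b - a))%:E)%E.
    by rewrite SE lee_fin expr1n mul1r; lra.
  have osc1 c d : a <= c -> c < d -> d <= b -> exists k : R,
      (\int[mu]_(x in `]c, d[) ((phi1 x - k)^+2)%:E <= (1^+2 * (d - c))%:E)%E.
    move=> ac cd db; have [k Hk] := osc ac cd db; exists k; apply: (le_trans Hk).
    by rewrite N00 lee_fin expr0n mul0r expr1n mul1r; lra.
  have := central_moment_le_variance ab ltr01 mphi1 osc1 oscm1 h3.
  rewrite powR1 mulr1 SE -EFinM.
  have : p2 * Gamma p2 * S <= 0 by rewrite pmulr_rle0.
  have R0 : (0 <= (p2 * Gamma p2 / (p1 * Gamma p1))%:E * (N `^ (p2 - p1))%:E *
      (((b - a)^-1)%:E * I1%:E))%E.
    rewrite -!EFinM lee_fin; apply: mulr_ge0; last exact: mulr_ge0.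
    exact: mulr_ge0 (divr_ge0 (ltW e2) (ltW e1)) (powR_ge0 _ _).
  move: (\int[mu]_(x in _) (_ `^ p2)%:E)%E => [I2| |].
  + rewrite -!EFinM lee_fin => H1 H2; apply: le_trans R0; rewrite lee_fin.
    by rewrite pmulr_rle0 ?invr_gt0//; lra.
  + by rewrite gt0_muley ?lte_fin.
  + by move=> _ _; rewrite gt0_muleNy ?leNye// lte_fin invr_gt0.
Qed.

End fixed_function.
End bmo_inequalities.

(** * A sufficient condition for a norm at most one *)

Section extremal_tools.
Context {R : realType}.
Notation mu := (@lebesgue_measure R).

(** Stated on the type carrying the Borel sets, as a measurable function, so
    that the image of a measure under it is a measure. *)
Definition reflection (e : R) (x : measurableTypeR R) : measurableTypeR R := e - x.

Lemma measurable_reflection e : measurable_fun setT (reflection e).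
Proof. exact: measurable_funB. Qed.

HB.instance Definition _ e :=
  isMeasurableFun.Build _ _ _ _ (reflection e) (measurable_reflection e).

Lemma lebesgue_measure_reflect (e : R) (A : set R) : measurable A ->
  pushforward mu (reflection e) A = mu A.
Proof.
move=> mA; apply/esym/lebesgue_measure_unique => //= _ [[p q]] _ <-.
rewrite /pushforward.
have -> : reflection e @^-1` `]p, q]%classic = `[e - q, e - p[%classic.
  by apply/seteqP; split => x; rewrite /= /reflection !in_itv/= => /andP[? ?];
    apply/andP; split; lra.
rewrite !lebesgue_measure_itv/= !lte_fin.
have -> : (e - q < e - p) = (p < q) by apply/idP/idP; lra.
by case: ifPn => // _; rewrite -!EFinB; congr (_%:E); ring.
Qed.

Lemma nnint_reflect (f : R -> R) (e s t : R) : measurable_fun setT f ->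
  (forall x, 0 <= f x) ->
  (\int[mu]_(x in `]s, t[) (f (e - x)%R)%:E = \int[mu]_(x in `](e - t)%R,
    (e - s)%R[) (f x)%:E)%E.
Proof.
move=> mf f0.
have -> : `]s, t[%classic = reflection e @^-1` `]e - t, e - s[%classic.
  by apply/seteqP; split => x; rewrite /= /reflection !in_itv/= => /andP[? ?];
    apply/andP; split; lra.
transitivity (\int[pushforward mu (reflection e)]_(x in `](e - t)%R, (e - s)%R[)
  (f x)%:E)%E.
  apply/esym; apply: (ge0_integral_pushforward (measurable_reflection e)) => //.
    by apply/measurable_EFinP; exact: measurable_funTS.
  by move=> x _; rewrite lee_fin.
by apply: eq_measure_integral => //= A mA AS; exact: lebesgue_measure_reflect.
Qed.

Section criterion.
Variables (a b : R) (b0 b1 : bool).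
Hypothesis ab : a < b.
Let Q : set R := [set` Interval (BSide b0 a) (BSide b1 b)].
Variable phi : R -> R.
Hypothesis mphi : measurable_fun setT phi.
Hypothesis phi2 : (\int[mu]_(x in `]a, b[) ((phi x)^+2)%:E < +oo)%E.
Hypothesis osc : forall c d, a <= c -> c < d -> d <= b -> exists k : R,
  (\int[mu]_(x in `]c, d[) ((phi x - k)^+2)%:E <= (d - c)%:E)%E.

Lemma integrable_of_sqr : mu.-integrable Q (EFin \o phi).
Proof.
apply/integrableP; split; first by apply/measurable_EFinP; exact: measurable_funTS.
rewrite integral_itv_bndoo; last first.
  apply: measurableT_comp => //; apply/measurable_EFinP; exact: measurable_funTS.
have m2 : measurable_fun setT (fun x => (phi x)^+2) by exact: measurable_funX.
apply: (@le_lt_trans _ _ (\int[mu]_(x in `]a, b[) ((phi x)^+2 + cst 1 x)%:E)%E).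
  apply: le_nnint => //.
  - exact: measurableT_comp.
  - exact: measurable_funD.
  move=> x _; rewrite normr_ge0/= -[(phi x)^+2]real_normK ?num_real//.
  by have := sqr_ge0 (`|phi x| - 1); have := normr_ge0 (phi x);
    rewrite sqrrB expr1n; lra.
rewrite (nnintD (measurable_itv _) m2 (measurable_cst _) (fun x _ => sqr_ge0 _)
  (fun _ _ => ler01)).
by rewrite (nnint_cst_oo _ (ltW ab)) lte_add_pinfty// ltry.
Qed.

Lemma bmo_norm_le1 : (bmo_norm Q phi <= 1%:E)%E.
Proof.
apply: ge_ereal_sup => _ [J [bJ JQ] <-].
have [c [d [c0 [c1 [cd EJ]]]]] := bounded_intervalE bJ.
have sub : `]c, d[ `<=` `[a, b].
  move=> x xcd; have /JQ : J x by rewrite EJ; exact: subset_itvW xcd.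
  by rewrite /Q /=; apply: subset_itv; rewrite bnd_simp.
have ac : a <= c.
  rewrite leNgt; apply/negP => ca.
  have /sub : `]c, d[%classic (Num.min ((c + a) / 2) ((c + d) / 2)).
    by rewrite /= in_itv/= lt_min gt_min; apply/andP; split; [apply/andP;
      split|apply/orP; right]; lra.
  by rewrite /= in_itv/= le_min => /andP[/andP[]]; lra.
have db : d <= b.
  rewrite leNgt; apply/negP => bd.
  have /sub : `]c, d[%classic (Num.max ((d + b) / 2) ((c + d) / 2)).
    by rewrite /= in_itv/= gt_max lt_max; apply/andP; split; [apply/orP;
      right|apply/andP; split]; lra.
  by rewrite /= in_itv/= ge_max => /andP[_ /andP[]]; lra.
have [k Hk] := osc ac cd db.
rewrite EJ; apply: (oscillation_le1 _ _ cd _ _ Hk).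
- apply: (integrableS _ _ _ integrable_of_sqr) => //; first exact: measurable_itv.
  by move=> x xcd; apply: JQ; rewrite EJ; exact: subset_itvW xcd.
- apply/integrableP; split.
    by apply/measurable_EFinP; apply: measurable_funTS; exact: measurable_funX.
  under eq_integral do rewrite /= ger0_norm ?sqr_ge0//.
  apply: le_lt_trans phi2; apply: ge0_subset_integral => //.
  + by apply/measurable_EFinP; apply: measurable_funTS; exact: measurable_funX.
  + by move=> x _; rewrite lee_fin sqr_ge0.
  + exact: subset_itvW.
Qed.

Lemma in_BMO_criterion : in_BMO Q phi.
Proof.
by split; [exact: integrable_of_sqr|apply: le_lt_trans bmo_norm_le1 _; exact: ltry].
Qed.

End criterion.

Lemma avg_diff0 (a b : R) (b0 b1 : bool) (Y1 Y2 : R -> R) (I : R) : a < b ->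
  measurable_fun setT Y1 -> measurable_fun setT Y2 ->
  (forall x, 0 <= Y1 x) -> (forall x, 0 <= Y2 x) ->
  (\int[mu]_(x in `]a, b[) (Y1 x)%:E = I%:E)%E ->
  (\int[mu]_(x in `]a, b[) (Y2 x)%:E = I%:E)%E ->
  avg [set` Interval (BSide b0 a) (BSide b1 b)] (fun x => Y1 x - Y2 x) = 0%E.
Proof.
move=> ab m1 m2 Y10 Y20 E1 E2.
rewrite avg_itv//; last by apply: measurable_funTS; exact: measurable_funB.
under eq_integral do rewrite EFinB.
rewrite integralB//.
- by rewrite E1 E2 subee// mule0.
- apply/integrableP; split; first by apply/measurable_EFinP;
  exact: measurable_funTS.
  by under eq_integral do rewrite /= ger0_norm//; rewrite E1 ltry.
- apply/integrableP; split; first by apply/measurable_EFinP;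
  exact: measurable_funTS.
  by under eq_integral do rewrite /= ger0_norm//; rewrite E2 ltry.
Qed.

End extremal_tools.

(** * Functions attaining equality *)

Section step_function.
Context {R : realType}.
Notation mu := (@lebesgue_measure R).
Variables (a b : R) (b0 b1 : bool).
Hypothesis ab : a < b.
Let Q : set R := [set` Interval (BSide b0 a) (BSide b1 b)].

Let h := (a + b) / 2.
Let Y1 : R -> R := \1_(`]-oo, h[%classic).
Let Y2 : R -> R := \1_(`[h, +oo[%classic).

Definition step_function (x : R) : R := Y1 x - Y2 x.

Let m1 : measurable_fun setT Y1. Proof. exact: measurable_indic. Qed.
Let m2 : measurable_fun setT Y2. Proof. exact: measurable_indic. Qed.

Let mstep : measurable_fun setT step_function.
Proof. exact: measurable_funB. Qed.

Let norm_step x : `|step_function x| = 1.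
Proof.
rewrite /step_function /Y1 /Y2 !indicE !mem_setE !in_itv/= andbT.
by case: ltP => _; rewrite /= ?subr0 ?sub0r ?normrN normr1.
Qed.

Let sqr_step x : (step_function x)^+2 = 1.
Proof. by rewrite -real_normK ?num_real// norm_step expr1n. Qed.

Let int_step c d : c <= d ->
  (\int[mu]_(x in `]c, d[) ((step_function x)^+2)%:E = (d - c)%:E)%E.
Proof.
move=> cd; under eq_integral do rewrite sqr_step.
by rewrite nnint_cst_oo// mul1r.
Qed.

Lemma step_function_BMO : in_BMO Q step_function.
Proof.
apply: in_BMO_criterion => //; first by rewrite int_step ?(ltW ab)// ltry.
move=> c d _ cd _; exists 0; under eq_integral do rewrite subr0.
by rewrite int_step// ltW.
Qed.

Let avg_step : avg Q step_function = 0%E.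
Proof.
have H : (b - h = (b - a) / 2) /\ (h - a = (b - a) / 2) by rewrite /h; split; lra.
have ah : a < h by move: ab; rewrite /h; lra.
have hb : h < b by move: ab; rewrite /h; lra.
apply: (@avg_diff0 _ a b b0 b1 Y1 Y2 ((b - a) / 2)) => //.
- rewrite integral_indic//.
  have -> : `]-oo, h[ `&` `]a, b[ = `]a, h[%classic :> set R.
    apply/seteqP; split => x /=; rewrite !in_itv/=.
      by move=> [-> /andP[->]].
    by move=> /andP[-> xh]; rewrite xh (lt_trans xh hb).
  by rewrite /= lebesgue_measure_itv/= lte_fin ah -EFinB; case: H => _ ->.
- rewrite integral_indic//.
  have -> : `[h, +oo[ `&` `]a, b[ = `[h, b[%classic :> set R.
    apply/seteqP; split => x /=; rewrite !in_itv/= andbT.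
      by move=> [-> /andP[_ ->]].
    by move=> /andP[hx ->]; rewrite hx (lt_le_trans ah hx).
  by rewrite /= lebesgue_measure_itv/= lte_fin hb -EFinB; case: H => ->.
Qed.

Lemma step_function_norm : bmo_norm Q step_function <> 0%E.
Proof.
have : (1%:E <= bmo_norm Q step_function)%E.
  apply: ereal_sup_ubound; exists Q; first by split => //;
    exact: bounded_interval_itv.
  rewrite avg_step avg_itv//; last by apply: measurable_funTS;
    exact: measurable_funX.
  rewrite int_step ?(ltW ab)// -EFinM mulVf ?subr_eq0 ?gt_eqF//.
  by rewrite expe2 mule0 sube0 poweR_EFin powR1.
by move=> /[swap] ->; rewrite lee_fin ler10.
Qed.

Lemma step_function_moment p : central_moment Q step_function p = 1%E.
Proof.
rewrite /central_moment avg_step /= avg_itv//; last first.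
  apply: measurable_funTS; apply: (measurableT_comp (@measurable_powR R p)).
  by apply: measurableT_comp => //; exact: measurable_funB.
under eq_integral do rewrite subr0 norm_step powR1.
rewrite nnint_cst_oo ?(ltW ab)// mul1r -EFinM mulVf//.
by rewrite subr_eq0 gt_eqF.
Qed.

End step_function.

Section log_function.
Context {R : realType}.
Notation mu := (@lebesgue_measure R).

(** On ]a, a + l[, for the normalized Lebesgue measure, this is an exponential
    variable; it vanishes to the right of a + l. *)
Definition logvar (a l x : R) : R := expvar 0 ((x - a) / l).

Lemma measurable_logvar a l : measurable_fun setT (logvar a l).
Proof.
apply: (measurableT_comp (measurable_expvar 0)).
by apply: measurable_funM => //; exact: measurable_funB.
Qed.

Lemma logvar_ge0 a l x : 0 <= logvar a l x. Proof. exact: expvar_ge0. Qed.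

Lemma logvar_moment (a b l p : R) : 0 < l -> a + l <= b -> 0 < p ->
  (\int[mu]_(x in `]a, b[) (logvar a l x `^ p)%:E = l%:E * expmom p)%E.
Proof.
move=> l0 alb p0.
apply: (exp_tail_moment p0 (ltW l0) (measurable_itv _) (measurable_logvar a l)).
  by move=> x _; exact: logvar_ge0.
move=> t t0.
have e0 := expR_gt0 (- t).
have e1 : expR (- t) < 1 by rewrite expR_lt1; lra.
have le1 : l * expR (- t) < l by rewrite gtr_pMr.
have le0 : 0 < l * expR (- t) by rewrite mulr_gt0.
have -> : `]a, b[ `&` [set x | t < logvar a l x] = `]a, a + l * expR (- t)[%classic.
  apply/seteqP; split => x /=; rewrite !in_itv/= /logvar /expvar subr0 lt_max
    (ltNge t 0) (ltW t0) orbF.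
    move=> [/andP[ax xb] tx]; rewrite ax/=.
    have xl0 : 0 < (x - a) / l by rewrite divr_gt0// subr_gt0.
    have : (x - a) / l < expR (- t) by rewrite -ltr_ln ?posrE// expRK; lra.
    by rewrite ltr_pdivrMr// mulrC; lra.
  move=> /andP[ax xe].
  have xl0 : 0 < (x - a) / l by rewrite divr_gt0// subr_gt0.
  have : (x - a) / l < expR (- t) by rewrite ltr_pdivrMr// mulrC; lra.
  rewrite -ltr_ln ?posrE// expRK => H.
  by split; [apply/andP; split|]; lra.
rewrite lebesgue_measure_itv/= lte_fin ltrDl le0 -EFinB; congr (_%:E); ring.
Qed.

Let pow2E (Y : R -> R) x : 0 <= Y x -> (Y x) `^ 2 = (Y x)^+2.
Proof. by move=> Y0; rewrite (@powR_mulrn _ _ 2). Qed.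

Lemma logvar_int (a b l : R) : 0 < l -> a + l <= b ->
  (\int[mu]_(x in `]a, b[) (logvar a l x)%:E = l%:E)%E.
Proof.
move=> l0 alb; have := logvar_moment l0 alb (@ltr01 R).
rewrite expmom1 mule1 => <-; apply: eq_integral => x _.
by rewrite powRr1// logvar_ge0.
Qed.

Lemma logvar_int2 (a b l : R) : 0 < l -> a + l <= b ->
  (\int[mu]_(x in `]a, b[) ((logvar a l x)^+2)%:E = (2 * l)%:E)%E.
Proof.
move=> l0 alb; have := logvar_moment l0 alb (ltr0Sn R 1).
rewrite expmom2 -EFinM [l * 2]mulrC => <-; apply: eq_integral => x _.
by rewrite pow2E// logvar_ge0.
Qed.

Lemma logvar_rescale (a s t x : R) : a < s -> s <= t -> a < x -> x < s ->
  logvar a (t - a) x = logvar a (s - a) x + (ln (t - a) - ln (s - a)).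
Proof.
move=> as_ st ax xs.
have [xa sa ta] : [/\ 0 < x - a, 0 < s - a & 0 < t - a] by split; lra.
have l1 : ln (x - a) <= ln (s - a) by rewrite ler_ln ?posrE//; lra.
have l2 : ln (s - a) <= ln (t - a) by rewrite ler_ln ?posrE//; lra.
by rewrite /logvar /expvar !subr0 !ln_div ?posrE// !max_l; lra.
Qed.

(** Over ]a, t[ the variable Z = logvar a (t - a) is exponential, so that
    (Z - 1)^2 has mean 1.  Over ]a, s[ it is an exponential variable translated
    by tau >= 0, so that (Z - 1)^2 has mean 1 + tau^2 >= 1.  Hence the mean over
    the remaining interval ]s, t[ is at most 1. *)
Lemma logvar_osc_self (a s t : R) : a <= s -> s < t ->
  (\int[mu]_(x in `]s, t[) ((logvar a (t - a) x - 1)^+2)%:E <= (t - s)%:E)%E.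
Proof.
move=> as_ st.
have ta : 0 < t - a by lra.
have at_ : a + (t - a) <= t by lra.
have mZ1 : measurable_fun setT (fun x => (logvar a (t - a) x - 1)^+2).
  by apply: measurable_funX; apply: measurable_funB => //; exact: measurable_logvar.
have full : (\int[mu]_(x in `]a, t[) ((logvar a (t - a) x - 1)^+2)%:E =
  (t - a)%:E)%E.
  have := nnint_sqr_shift (ltW (le_lt_trans as_ st)) (measurable_logvar a
    (t - a)) (logvar_ge0 a (t - a)) (@ler01 R).
  rewrite logvar_int// logvar_int2//.
  move: (\int[mu]_(x in _) _)%E => [u| |]//; rewrite -!EFinM -!EFinD => -[E].
  by congr (_%:E); lra.
move: as_; rewrite le_eqVlt => /predU1P[<-|as_]; first by rewrite full.
have sa : 0 < s - a by lra.
have as2 : a + (s - a) <= s by lra.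
pose tau := ln (t - a) - ln (s - a).
have tau0 : 0 <= tau by rewrite subr_ge0 ler_ln ?posrE//; lra.
have ZE : {in `]a, s[%classic, logvar a (t - a) =1 (fun x => logvar a (s - a)
  x + tau)}.
  by move=> x; rewrite inE/= in_itv/= => /andP[ax xs];
    apply: logvar_rescale => //; exact: ltW.
have mW := measurable_logvar a (s - a).
have mW2 : measurable_fun setT (fun x => (logvar a (s - a) x)^+2)
  by exact: measurable_funX.
have mtW : measurable_fun setT (fun x => 2 * tau * logvar a (s - a) x)
  by exact: measurable_funM.
have tau2 : 0 <= 2 * tau by rewrite mulr_ge0.
have W0 x (S : set R) : S x -> 0 <= logvar a (s - a) x by move=> _;
  exact: logvar_ge0.
have tW0 x (S : set R) : S x -> 0 <= 2 * tau * logvar a (s - a) x.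
  by move=> _; rewrite mulr_ge0// logvar_ge0.
have i1 : (\int[mu]_(x in `]a, s[) (logvar a (t - a) x)%:E = ((s - a) *
  (1 + tau))%:E)%E.
  transitivity (\int[mu]_(x in `]a, s[) (logvar a (s - a) x + cst tau x)%:E)%E.
    by apply: eq_integral => x xs; rewrite ZE.
  rewrite (nnintD (measurable_itv _) mW (measurable_cst _) (fun x S => W0 x _ S)
    (fun _ _ => tau0)).
  rewrite logvar_int// (nnint_cst_oo _ (ltW as_)) -EFinD; congr (_%:E); ring.
have i2 : (\int[mu]_(x in `]a, s[) ((logvar a (t - a) x)^+2)%:E = ((s - a) *
  (2 + 2 * tau + tau ^+ 2))%:E)%E.
  transitivity (\int[mu]_(x in `]a, s[) ((logvar a (s - a) x)^+2 +
    (2 * tau * logvar a (s - a) x + cst (tau^+2) x))%:E)%E.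
    by apply: eq_integral => x xs; rewrite ZE//; congr (_%:E); rewrite /cst; ring.
  rewrite (nnintD (measurable_itv _) mW2 _ (fun _ _ => sqr_ge0 _)); last 2 first.
  - exact: measurable_funD.
  - by move=> x xs; rewrite addr_ge0// ?(tW0 x _ xs)// sqr_ge0.
  rewrite (nnintD (measurable_itv _) mtW (measurable_cst _) (fun x S =>
    tW0 x _ S) (fun _ _ => sqr_ge0 _)).
  rewrite (nnintZ (measurable_itv _) mW (fun x S => W0 x _ S) tau2).
  rewrite logvar_int// logvar_int2// (nnint_cst_oo _ (ltW as_)) -!EFinM -!EFinD;
    congr (_%:E); ring.
have part : ((s - a)%:E <= \int[mu]_(x in `]a, s[) ((logvar a (t - a)
  x - 1)^+2)%:E)%E.
  have := nnint_sqr_shift (ltW as_) (measurable_logvar a (t - a)) (logvar_ge0 a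
    (t - a)) (@ler01 R).
  rewrite i1 i2; have : 0 <= (s - a) * tau ^+ 2 by rewrite mulr_ge0 ?sqr_ge0// ltW.
  move: (\int[mu]_(x in _) _)%E => [u| |]//; rewrite -?EFinM -?EFinD// => H -[E].
  by rewrite lee_fin; lra.
move: full; rewrite (@itv_bndbnd_setU _ _ _ (BLeft s)) ?bnd_simp//; last exact: ltW.
rewrite ge0_integral_setU//; first last.
- by apply/disj_setPS => x []/=; rewrite !in_itv/=; lra.
- by move=> x _; rewrite lee_fin sqr_ge0.
- by apply/measurable_EFinP; exact: measurable_funTS.
rewrite -(integral_itv_obnd_cbnd (r := s)); last first.
  by apply/measurable_EFinP; exact: measurable_funTS.
move: part (nnint_ge0 `]s, t[ (fun x => sqr_ge0 (logvar a (t - a) x - 1))).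
move: (\int[mu]_(x in `]a, s[) _)%E => u.
move: (\int[mu]_(x in `]s, t[) _)%E => [v| |]//; case: u => [u| |]//.
by rewrite !lee_fin -EFinD => H _ [E]; lra.
Qed.

(** On ]s, t[ the function is the positive part of a translate of
    logvar a (t - a), and the positive part is 1-Lipschitz. *)
Lemma logvar_osc (a c s t : R) : 0 < c -> a <= s -> s < t -> exists k : R,
  (\int[mu]_(x in `]s, t[) ((logvar a c x - k)^+2)%:E <= (t - s)%:E)%E.
Proof.
move=> c0 as_ st.
have ta : 0 < t - a by lra.
pose kap := ln c - ln (t - a).
exists (Num.max (1 + kap) 0).
apply: le_trans (logvar_osc_self as_ st); apply: le_nnint => //.
- by apply: measurable_funX; apply: measurable_funB => //; exact: measurable_logvar.
- by apply: measurable_funX; apply: measurable_funB => //; exact: measurable_logvar.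
move=> x /=; rewrite in_itv/= => /andP[sx xt]; rewrite sqr_ge0/=.
have xa : 0 < x - a by lra.
have l1 : ln (x - a) <= ln (t - a) by rewrite ler_ln ?posrE//; lra.
rewrite /logvar /expvar !subr0 !ln_div ?posrE// [X in (X - 1)^+2]max_l; last by lra.
rewrite -[leLHS]real_normK ?num_real// -[leRHS]real_normK ?num_real//.
apply: lerXn2r; rewrite ?nnegrE//.
rewrite /kap; move: (ln (x - a)) (ln (t - a)) (ln c) => u v w.
have E : `|- (u - v) - 1| = `|(- (u - w)) - (1 + (w - v))| by congr (`|_|); ring.
rewrite E; move: (- (u - w)) (1 + (w - v)) => y z.
rewrite ler_norml; have := ler_norm (y - z); have := ler_norm (- (y - z)).
rewrite normrN => ? ?.
by case: (leP y 0); case: (leP z 0) => ? ?; apply/andP; split; lra.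
Qed.

End log_function.

Section two_sided_logarithm.
Context {R : realType}.
Notation mu := (@lebesgue_measure R).
Variables (a b : R) (b0 b1 : bool).
Hypothesis ab : a < b.
Let Q : set R := [set` Interval (BSide b0 a) (BSide b1 b)].

(* the sixth of the length is the largest width for which an interval meeting
   both supports, of length at least b - a - 2 c = 4 c, is longer than the
   integral 4 c of the square *)
Let c := (b - a) / 6.
Let c0 : 0 < c. Proof. by rewrite divr_gt0// subr_gt0. Qed.
Let cE : b - a = 6 * c. Proof. by rewrite /c mulrC divfK. Qed.

Let Y1 x := logvar a c x.
Let Y2 x := logvar a c (a + b - x).

Definition two_sided_log (x : R) : R := Y1 x - Y2 x.

Let m1 : measurable_fun setT Y1. Proof. exact: measurable_logvar. Qed.
Let m2 : measurable_fun setT Y2.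
Proof.
by apply: (measurableT_comp (measurable_logvar a c)); exact: measurable_funB.
Qed.
Let Y10 x : 0 <= Y1 x. Proof. exact: logvar_ge0. Qed.
Let Y20 x : 0 <= Y2 x. Proof. exact: logvar_ge0. Qed.

Let mphi : measurable_fun setT two_sided_log.
Proof. exact: measurable_funB. Qed.

Let logvar0 x : a + c <= x -> logvar a c x = 0.
Proof.
move=> acx; rewrite /logvar /expvar subr0 max_r// oppr_le0 ln_ge0//.
by rewrite ler_pdivlMr// mul1r; lra.
Qed.

Let Y1_eq0 x : a + c <= x -> Y1 x = 0. Proof. exact: logvar0. Qed.
Let Y2_eq0 x : x <= b - c -> Y2 x = 0. Proof. by move=> xbc; apply: logvar0;
  lra. Qed.

Let disjoint_supports x : Y1 x = 0 \/ Y2 x = 0.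
Proof.
have [h|h] := leP (a + c) x; first by left; exact: Y1_eq0.
by right; apply: Y2_eq0; have := cE; have := c0; lra.
Qed.

Let acb : a + c <= b. Proof. by have := cE; have := c0; lra. Qed.

Let int_reflect (f : R -> R) : measurable_fun setT f -> (forall x, 0 <= f x) ->
  (\int[mu]_(x in `]a, b[) (f (a + b - x)%R)%:E = \int[mu]_(x in `]a, b[)
    (f x)%:E)%E.
Proof.
move=> mf f0; rewrite nnint_reflect//.
by rewrite addrK [a + b]addrC addrK.
Qed.

Let intY1 p : 0 < p -> (\int[mu]_(x in `]a, b[) (Y1 x `^ p)%:E = c%:E * expmom p)%E.
Proof. exact: logvar_moment. Qed.

Let mpow p (f : R -> R) : measurable_fun setT f ->
  measurable_fun setT (fun x => f x `^ p).
Proof. by move=> mf; apply: (measurableT_comp (@measurable_powR R p)). Qed.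

Let intY2 p : 0 < p -> (\int[mu]_(x in `]a, b[) (Y2 x `^ p)%:E = c%:E * expmom p)%E.
Proof.
move=> p0; rewrite -(intY1 p0).
exact: (int_reflect (mpow p m1) (fun x => powR_ge0 _ _)).
Qed.

(** The two logarithms have disjoint supports and the same moments, by
    reflection. *)
Lemma two_sided_log_moment p : 0 < p ->
  (\int[mu]_(x in `]a, b[) (`|two_sided_log x| `^ p)%:E = (2 * c *
    (p * Gamma p))%:E)%E.
Proof.
move=> p0.
have -> : (\int[mu]_(x in `]a, b[) (`|two_sided_log x| `^ p)%:E =
    \int[mu]_(x in `]a, b[) (Y1 x `^ p + Y2 x `^ p)%:E)%E.
  apply: eq_integral => x _; congr (_%:E); rewrite /two_sided_log.
  case: (disjoint_supports x) => ->.
    by rewrite sub0r normrN ger0_norm// powR0 ?gt_eqF// add0r.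
  by rewrite subr0 ger0_norm// [0 `^ p]powR0 ?gt_eqF// addr0.
rewrite (nnintD (measurable_itv _) (mpow _ m1) (mpow _ m2) (fun _ _ =>
  powR_ge0 _ _) (fun _ _ => powR_ge0 _ _)).
by rewrite (intY1 p0) (intY2 p0) (expmomE p0) -!EFinM -EFinD; congr (_%:E); ring.
Qed.

Let int_sqr : (\int[mu]_(x in `]a, b[) ((two_sided_log x)^+2)%:E = (4 * c)%:E)%E.
Proof.
have E : 2 * Gamma 2 = 2 :> R by have := @expmomE R 2 (ltr0Sn _ 1);
  rewrite expmom2 => -[].
have -> : (4 * c)%:E = (2 * c * (2 * Gamma 2))%:E :> \bar R by rewrite E;
  congr (_%:E); ring.
rewrite -(two_sided_log_moment (ltr0Sn _ 1)); apply: eq_integral => x _.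
by rewrite (@powR_mulrn _ _ 2)// real_normK ?num_real.
Qed.

Let osc s t : a <= s -> s < t -> t <= b -> exists k : R,
  (\int[mu]_(x in `]s, t[) ((two_sided_log x - k)^+2)%:E <= (t - s)%:E)%E.
Proof.
move=> as_ st tb.
have [tbc|tbc] := leP t (b - c).
  have [k Hk] := logvar_osc c0 as_ st; exists k.
  apply: le_trans Hk; rewrite le_eqVlt; apply/orP; left; apply/eqP.
  apply: eq_integral => x; rewrite inE/= in_itv/= => /andP[sx xt].
  by rewrite /two_sided_log Y2_eq0 ?subr0//; lra.
have [sac|sac] := leP (a + c) s.
  have as' : a <= a + b - t by lra.
  have st' : a + b - t < a + b - s by lra.
  have [k Hk] := logvar_osc c0 as' st'; exists (- k).
  have -> : (t - s)%:E = (a + b - s - (a + b - t))%:E :> \bar R by congr (_%:E);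
    ring.
  apply: le_trans Hk; rewrite -(nnint_reflect (f :=
    fun x => (logvar a c x - k)^+2)); first last.
  - by move=> x; exact: sqr_ge0.
  - by apply: measurable_funX; exact: measurable_funB.
  rewrite le_eqVlt; apply/orP; left; apply/eqP.
  apply: eq_integral => x; rewrite inE/= in_itv/= => /andP[sx xt].
  rewrite /two_sided_log Y1_eq0 ?sub0r; last by lra.
  by congr (_%:E); rewrite -/(Y2 x); ring.
exists 0; apply: (@le_trans _ _ (\int[mu]_(x in `]a, b[)
  ((two_sided_log x)^+2)%:E)%E).
  under eq_integral do rewrite subr0.
  apply: ge0_subset_integral => //.
  - by apply/measurable_EFinP; apply: measurable_funTS; exact: measurable_funX.
  - by move=> x _; rewrite lee_fin sqr_ge0.
  - exact: subset_itvW.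
by rewrite int_sqr lee_fin; have := cE; lra.
Qed.

Lemma two_sided_log_BMO : in_BMO Q two_sided_log.
Proof. by apply: in_BMO_criterion => //; rewrite int_sqr ltry. Qed.

Let norm_le1 : (bmo_norm Q two_sided_log <= 1%:E)%E.
Proof. by apply: bmo_norm_le1 => //; rewrite int_sqr ltry. Qed.

Let avg0 : avg Q two_sided_log = 0%E.
Proof.
have pow1 f : (forall x, 0 <= f x) -> (\int[mu]_(x in `]a, b[)
  (f x `^ 1)%:E = \int[mu]_(x in `]a, b[) (f x)%:E)%E.
  by move=> f0; apply: eq_integral => x _; rewrite powRr1.
apply: (@avg_diff0 _ a b b0 b1 Y1 Y2 c) => //.
- by rewrite -(pow1 _ Y10) (intY1 ltr01) expmom1 mule1.
- by rewrite -(pow1 _ Y20) (intY2 ltr01) expmom1 mule1.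
Qed.

Lemma two_sided_log_central_moment p : 0 < p ->
  central_moment Q two_sided_log p = (p * Gamma p / 3)%:E.
Proof.
move=> p0.
rewrite /central_moment avg0 /= avg_itv//; last first.
  by apply: measurable_funTS; apply: mpow; apply: measurableT_comp => //;
    exact: measurable_funB.
under eq_integral do rewrite subr0.
rewrite (two_sided_log_moment p0) -EFinM; congr (_%:E); rewrite cE; field.
exact: lt0r_neq0.
Qed.

(** The estimates of oscillations give a norm at most 1, and a smaller norm
    would contradict the upper inequality between the orders 1 and 2. *)
Lemma two_sided_log_norm : bmo_norm Q two_sided_log = 1%:E.
Proof.
have := central_moment_upper ab two_sided_log_BMO (lexx 1) (ler1n _ 2) (lexx 2).
rewrite !two_sided_log_central_moment//.
have := norm_le1; have := bmo_norm_ge0 two_sided_log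
  (bounded_interval_itv b0 b1 ab).
rewrite -/Q; move: (bmo_norm Q two_sided_log) => [N| |]//;
  rewrite !lee_fin => N0 N1.
have e1 := mulr_Gamma_gt0 (@ltr01 R).
have e2 := mulr_Gamma_gt0 (ltr0Sn R 1).
rewrite (_ : 2 - 1 = 1); last by ring.
rewrite powRr1// => H; congr (_%:E); apply/eqP; rewrite eq_le N1/=.
have {H} : 2 * Gamma 2 <= 2 * Gamma 2 * N.
  move: H e1; move: (1 * Gamma 1) (2 * Gamma 2) => e f H /lt0r_neq0 e0.
  have E : f / e * N * (e / 3) = f * N / 3 by field.
  by move: H; rewrite E; lra.
by rewrite ler_pMr.
Qed.

End two_sided_logarithm.

Unset Implicit Arguments.

Theorem theorem2p4 (R : realType) (Q : set R) (p1 p2 : R)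
    (hQ : bounded_interval Q) (hp1 : 1 <= p1 <= 2) (hp2 : 2 <= p2) :
  [/\ forall phi : R -> R, in_BMO Q phi ->
        (central_moment Q phi p1 `^ (p2 / p1) <= central_moment Q phi p2)%E /\
        (central_moment Q phi p2 <=
           ((p2 * Gamma p2) / (p1 * Gamma p1))%:E
           * bmo_norm Q phi `^ (p2 - p1) * central_moment Q phi p1)%E,
      exists phi : R -> R,
        [/\ in_BMO Q phi, bmo_norm Q phi <> 0%E &
            (central_moment Q phi p1 `^ (p2 / p1) = central_moment Q phi p2)%E]
    & exists phi : R -> R,
        [/\ in_BMO Q phi, bmo_norm Q phi <> 0%E &
            (central_moment Q phi p2 =
               ((p2 * Gamma p2) / (p1 * Gamma p1))%:E
               * bmo_norm Q phi `^ (p2 - p1) * central_moment Q phi p1)%E]].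
Proof.
have [a [b [b0 [b1 [ab ->]]]]] := bounded_intervalE hQ.
have /andP[h1 h2] := hp1.
have p10 : 0 < p1 by lra.
have p20 : 0 < p2 by lra.
split.
- by move=> phi bmo; split; [exact: central_moment_lower|exact:
  central_moment_upper].
- exists (step_function a b); split.
  + exact: step_function_BMO.
  + exact: step_function_norm.
  + by rewrite !step_function_moment// poweR1r.
- exists (two_sided_log a b); split.
  + exact: two_sided_log_BMO.
  + by rewrite two_sided_log_norm// => -[] /eqP; rewrite oner_eq0.
  + rewrite two_sided_log_norm// !two_sided_log_central_moment// poweR_EFin powR1.
    rewrite -!EFinM mulr1; congr (_%:E).
    by have /lt0r_neq0 := mulr_Gamma_gt0 p10;
      move: (p1 * Gamma p1) (p2 * Gamma p2) => e f e0; field.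
Qed.
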